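(* There exists an algorithm which, given as input a finite set $\mathcal{L}$ of $n$ $l$'s (each specified by the coordinates of its corner and the endpoints of its two arms), runs in $O(n(\log n)^2)$ time and outputs an independent set $I\subseteq\mathcal{L}$ of the intersection graph of $\mathcal{L}$ with $|I|\ \ge\ \alpha/(36\log(2d_x)\log(2d_y))$, where $\alpha$ is the maximum size of an independent set of that intersection graph, $d_x=d^x_{max}(\mathcal{L})/d^x_{min}(\mathcal{L})$, $d_y=d^y_{max}(\mathcal{L})/d^y_{min}(\mathcal{L})$, and $\log$ is to base 2.
   Context: An $l$ is a planar object which is the union of a horizontal and a vertical line segment (its two arms) of positive length sharing a common endpoint (its corner), in one of the four shapes $\llcorner$, $\ulcorner$, $\urcorner$, $\lrcorner$; e.g. an $l$ of shape $\llcorner$ with corner $(x_c,y_c)$ is the point set $\{(x,y_c): x_c\le x\le x_h\}\cup\{(x_c,y): y_c\le y\le y_v\}$ with $x_h>x_c$, $y_v>y_c$, and the other shapes are its rotations. The two arms of an $l$ may have different lengths. $d^x_{max}(\mathcal{L})$ and $d^x_{min}(\mathcal{L})$ denote the maximum and minimum length of the horizontal arm over members of $\mathcal{L}$; $d^y_{max}(\mathcal{L})$ and $d^y_{min}(\mathcal{L})$ are defined similarly for vertical arms. Two distinct $l$'s intersect if their point sets have a common point; the intersection graph of $\mathcal{L}$ has vertex set $\mathcal{L}$ and an edge between every intersecting pair (such graphs are the $B_1$-VPG graphs). An independent set is a subset of $\mathcal{L}$ no two members of which intersect. *)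

(* Defs.v *)
From HB Require Import structures.
From mathcomp Require Import all_boot all_order all_algebra.
From mathcomp Require Import finmap.
From mathcomp Require Import all_classical all_reals all_analysis.

Set Implicit Arguments.
Unset Strict Implicit.
Unset Printing Implicit Defensive.

Import Order.TTheory GRing.Theory Num.Theory.
Import numFieldNormedType.Exports.

Local Open Scope ring_scope.

Definition log2 (R : realType) (x : R) : R := ln x / ln 2.

Section Ells.
Variable R : realType.

(* ((x_c, y_c), (x_h, y_v)) describes the l with corner (x_c, y_c) whose
   horizontal arm ends at (x_h, y_c) and whose vertical arm ends at (x_c, y_v).
   The signs of x_h - x_c and y_v - y_c determine which of the four shapes it
   has. *)
Record ell := Ell {
  coords : (R * R) * (R * R);
  _ : (coords.2.1 != coords.1.1) && (coords.2.2 != coords.1.2)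
}.

HB.instance Definition _ := [isSub for coords].
HB.instance Definition _ := [Choice of ell by <:].

Definition corner_x (l : ell) : R := (coords l).1.1.
Definition corner_y (l : ell) : R := (coords l).1.2.
Definition hend_x (l : ell) : R := (coords l).2.1.
Definition vend_y (l : ell) : R := (coords l).2.2.

Definition harm (l : ell) : set (R * R) :=
  [set p | Num.min (corner_x l) (hend_x l) <= p.1
             <= Num.max (corner_x l) (hend_x l) /\ p.2 = corner_y l]%classic.

Definition varm (l : ell) : set (R * R) :=
  [set p | p.1 = corner_x l /\ Num.min (corner_y l) (vend_y l) <= p.2
             <= Num.max (corner_y l) (vend_y l)]%classic.

Definition points (l : ell) : set (R * R) := (harm l `|` varm l)%classic.

Definition ell_adjacent (l1 l2 : ell) : Prop :=
  l1 <> l2 /\ (points l1 `&` points l2 !=set0)%classic.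

Definition independent (I : {fset ell}) : Prop :=
  forall l1 l2, l1 \in I -> l2 \in I -> ~ ell_adjacent l1 l2.

Definition alpha (L : {fset ell}) : nat :=
  \max_(I <- fpowerset L | `[< independent I >]) #|` I|.

Definition hlen (l : ell) : R := `|hend_x l - corner_x l|.
Definition vlen (l : ell) : R := `|vend_y l - corner_y l|.

Definition max_over (f : ell -> R) (L : {fset ell}) : R :=
  \big[Num.max/0]_(l <- L) f l.
(* Starting from the maximum makes this the true minimum when L is nonempty. *)
Definition min_over (f : ell -> R) (L : {fset ell}) : R :=
  \big[Num.min/max_over f L]_(l <- L) f l.

(* For empty L the quotient is 0 / 0 = 0. *)
Definition dx (L : {fset ell}) : R := max_over hlen L / min_over hlen L.
Definition dy (L : {fset ell}) : R := max_over vlen L / min_over vlen L.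

End Ells.

(* A real RAM, presented as a structured language.  The memory consists of banks
   of cells indexed by natural numbers: natural-number banks and real banks,
   each with indirect addressing (a load or store evaluates its address).  A
   program is a fixed finite term, hence uses finitely many banks, and a
   register is a cell with a constant address.
   - Real cells hold exact reals, with unit-cost +, -, *, / and comparison;
     the only real constants are natural numbers, there is no floor function,
     and no conversion from reals to addresses.
   - Natural-number cells support only +, truncated subtraction and comparison,
     so unit cost on unbounded integers cannot be exploited through
     multiplication or shifts.
   The cost of a run is the number of expression nodes evaluated and commands
   executed. *)
Inductive nexpr :=
| NConst of nat
| NLoad of nat & nexpr
| NAdd of nexpr & nexpr
| NSub of nexpr & nexpr.

Inductive rexpr :=
| RConst of nat
| RLoad of nat & nexpr
| RAdd of rexpr & rexpr
| RSub of rexpr & rexpr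
| RMul of rexpr & rexpr
| RDiv of rexpr & rexpr.

Inductive bexpr :=
| NLe of nexpr & nexpr
| RLe of rexpr & rexpr
| BNot of bexpr
| BAnd of bexpr & bexpr.

Inductive cmd :=
| Skip
| NStore of nat & nexpr & nexpr  (* bank, address, value *)
| RStore of nat & nexpr & rexpr
| Seq of cmd & cmd
| If of bexpr & cmd & cmd
| While of bexpr & cmd.

Fixpoint ncost (e : nexpr) : nat :=
  match e with
  | NConst _ => 1
  | NLoad _ e1 => (ncost e1).+1
  | NAdd e1 e2 | NSub e1 e2 => (ncost e1 + ncost e2).+1
  end.

Fixpoint rcost (e : rexpr) : nat :=
  match e with
  | RConst _ => 1
  | RLoad _ e1 => (ncost e1).+1
  | RAdd e1 e2 | RSub e1 e2 | RMul e1 e2 | RDiv e1 e2 =>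
      (rcost e1 + rcost e2).+1
  end.

Fixpoint bcost (e : bexpr) : nat :=
  match e with
  | NLe e1 e2 => (ncost e1 + ncost e2).+1
  | RLe e1 e2 => (rcost e1 + rcost e2).+1
  | BNot e1 => (bcost e1).+1
  | BAnd e1 e2 => (bcost e1 + bcost e2).+1
  end.

Section Semantics.
Variable R : realType.

Record state := State {
  nmem : nat -> nat -> nat;  (* bank, address *)
  rmem : nat -> nat -> R
}.

Fixpoint neval (s : state) (e : nexpr) : nat :=
  match e with
  | NConst k => k
  | NLoad b e1 => nmem s b (neval s e1)
  | NAdd e1 e2 => (neval s e1 + neval s e2)%N
  | NSub e1 e2 => (neval s e1 - neval s e2)%N
  end.

Fixpoint reval (s : state) (e : rexpr) : R :=
  match e with
  | RConst k => k%:R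
  | RLoad b e1 => rmem s b (neval s e1)
  | RAdd e1 e2 => reval s e1 + reval s e2
  | RSub e1 e2 => reval s e1 - reval s e2
  | RMul e1 e2 => reval s e1 * reval s e2
  | RDiv e1 e2 => reval s e1 / reval s e2
  end.

Fixpoint beval (s : state) (e : bexpr) : bool :=
  match e with
  | NLe e1 e2 => (neval s e1 <= neval s e2)%N
  | RLe e1 e2 => reval s e1 <= reval s e2
  | BNot e1 => ~~ beval s e1
  | BAnd e1 e2 => beval s e1 && beval s e2
  end.

Definition update (T : Type) (m : nat -> nat -> T) (b i : nat) (v : T) :
    nat -> nat -> T :=
  fun b' i' => if (b' == b) && (i' == i) then v else m b' i'.

(* [exec c s s' t]: started in s, the program c halts in s' at cost t.  The
   relation is functional in (c, s), and empty there when c diverges. *)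
Inductive exec : cmd -> state -> state -> nat -> Prop :=
| ExecSkip s : exec Skip s s 1
| ExecNStore s b a e :
    exec (NStore b a e) s
      (State (update (nmem s) b (neval s a) (neval s e)) (rmem s))
      (ncost a + ncost e).+1
| ExecRStore s b a e :
    exec (RStore b a e) s
      (State (nmem s) (update (rmem s) b (neval s a) (reval s e)))
      (ncost a + rcost e).+1
| ExecSeq c1 c2 s s1 s2 t1 t2 :
    exec c1 s s1 t1 -> exec c2 s1 s2 t2 -> exec (Seq c1 c2) s s2 (t1 + t2)
| ExecIf b c1 c2 s s' t :
    exec (if beval s b then c1 else c2) s s' t ->
    exec (If b c1 c2) s s' (bcost b + t).+1
| ExecWhileFalse b c s :
    beval s b = false -> exec (While b c) s s (bcost b).+1
| ExecWhileTrue b c s s1 s2 t1 t2 :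
    beval s b -> exec c s s1 t1 -> exec (While b c) s1 s2 t2 ->
    exec (While b c) s s2 (bcost b + t1 + t2).+1.

(* The number of l's is in cell 0 of natural-number bank 0, and the four
   coordinates of the i-th l of the list are in cells 4i, ..., 4i+3 of real
   bank 0; all other cells are 0. *)
Definition input (ls : seq (ell R)) : state :=
  State (fun b i => if (b == 0) && (i == 0) then size ls else 0)%N
        (fun b i => if b == 0%N then
           (flatten [seq [:: corner_x l; corner_y l; hend_x l; vend_y l]
                    | l <- ls])`_i
         else 0).

(* The i-th l of the list is selected when cell i of natural-number bank 1 is
   nonzero. *)
Definition output (ls : seq (ell R)) (s : state) : {fset ell R} :=
  [fset l in mask [seq nmem s 1 i != 0%N | i <- iota 0 (size ls)] ls]%fset.

End Semantics.

(* Main.v *)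
Require Import Defs.
From HB Require Import structures.
From mathcomp Require Import all_boot all_order all_algebra.
From mathcomp Require Import finmap.
From mathcomp Require Import all_classical all_reals all_analysis.
From mathcomp Require Import zify ring lra.

Set Implicit Arguments.
Unset Strict Implicit.
Unset Printing Implicit Defensive.

Import Order.TTheory GRing.Theory Num.Theory.
Import numFieldNormedType.Exports.

(* Reflecting every l to the shape with right and upward arms turns the four
   shapes into a code.  Scanning the sorted horizontal lengths greedily gives
   classes in which lengths differ by a factor less than 2; consecutive classes
   start at least a factor 2 apart, so there are at most log (2 d_x) of them.
   Within a class whose shortest length is a, a greedy scan of the corner
   abscissae gives strips of width at most a whose starts are at least a apart.
   The same is done vertically.  A cell is a shape together with a vertical and
   a horizontal strip; a group consists of the cells that agree in shape, in
   both length classes and in both strip numbers modulo 3, so there are at most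
   36 log (2 d_x) log (2 d_y) groups.
   - Two l's of one cell are disjoint iff their corners are strictly increasing
     in both coordinates, because their arms span the cell.
   - l's of different cells of one group are disjoint, because an l spans less
     than three strips.
   Order the l's by cell, then by increasing abscissa, then by decreasing
   ordinate, and take a longest subsequence on which (cell, ordinate) is
   lexicographically increasing.  Any independent set is such a subsequence, so
   this one has at least alpha members, and its members in any one group are
   independent; the most popular group is therefore good enough.  No floor
   function is needed: everything is done with sorting (bottom-up merge sort)
   and patience sorting, in time O(n log n). *)

Local Open Scope nat_scope.

(** * Runs of programs *)

Arguments update T m b i v b' / i'.

Fixpoint loop_free (c : cmd) : bool :=
  match c with
  | Seq c1 c2 | If _ c1 c2 => loop_free c1 && loop_free c2
  | While _ _ => false
  | _ => true
  end.

(** Charging both branches of a conditional makes the bound independent of the state. It bounds the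
    cost of loop-free commands only. *)
Fixpoint lcost (c : cmd) : nat :=
  match c with
  | Skip => 1
  | NStore _ a e => (ncost a + ncost e).+1
  | RStore _ a e => (ncost a + rcost e).+1
  | Seq c1 c2 => lcost c1 + lcost c2
  | If b c1 c2 => (bcost b + (lcost c1 + lcost c2)).+1
  | While _ _ => 0
  end.

Fixpoint nwritten (c : cmd) : seq nat :=
  match c with
  | NStore b _ _ => [:: b]
  | Seq c1 c2 | If _ c1 c2 => nwritten c1 ++ nwritten c2
  | While _ c1 => nwritten c1
  | _ => [::]
  end.

Fixpoint rwritten (c : cmd) : seq nat :=
  match c with
  | RStore b _ _ => [:: b]
  | Seq c1 c2 | If _ c1 c2 => rwritten c1 ++ rwritten c2
  | While _ c1 => rwritten c1
  | _ => [::]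
  end.

Notation reg b := (NLoad b (NConst 0)).
Definition nset (b : nat) (e : nexpr) : cmd := NStore b (NConst 0) e.

Definition for_loop (kb : nat) (e : nexpr) (body : cmd) : cmd :=
  Seq (nset kb (NConst 0))
    (While (NLe (NAdd (reg kb) (NConst 1)) e)
       (Seq body (nset kb (NAdd (reg kb) (NConst 1))))).

Section Runs.
Variable R : realType.
Implicit Types (s : state R) (c : cmd) (Q : state R -> Prop).

(** A functional reading of loop-free code: its final state is found by computation instead of by
    inversion of [exec]. Loops are excluded by [loop_free] wherever this is related to [exec]. *)
Fixpoint sem c s : state R :=
  match c with
  | NStore b a e =>
      State (update (nmem s) b (neval s a) (neval s e)) (rmem s)
  | RStore b a e =>
      State (nmem s) (update (rmem s) b (neval s a) (reval s e))
  | Seq c1 c2 => sem c2 (sem c1 s)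
  | If b c1 c2 => if beval s b then sem c1 s else sem c2 s
  | _ => s
  end.

Lemma exec_sem c s : loop_free c ->
  exists2 t, exec c s (sem c s) t & t <= lcost c.
Proof.
elim: c s => [|b a e|b a e|c1 IH1 c2 IH2|b c1 IH1 c2 IH2|b c1 _] //= s.
- by move=> _; exists 1 => //; constructor.
- by move=> _; eexists; [constructor|].
- by move=> _; eexists; [constructor|].
- move=> /andP[/(IH1 s)[t1 E1 le1] /(IH2 (sem c1 s))[t2 E2 le2]].
  by exists (t1 + t2); [apply: ExecSeq E1 E2 | lia].
- move=> /andP[/(IH1 s)[t1 E1 le1] /(IH2 s)[t2 E2 le2]].
  exists (bcost b + (if beval s b then t1 else t2)).+1; last by case: ifP; lia.
  by apply: ExecIf; case: ifP.
Qed.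

(** A total-correctness triple for one initial state, with a bound on the cost. *)
Definition runs c s (T : nat) Q :=
  exists s' t, [/\ exec c s s' t, t <= T & Q s'].

Lemma runs_weaken c s T T' Q Q' : runs c s T Q -> T <= T' ->
  (forall s', Q s' -> Q' s') -> runs c s T' Q'.
Proof.
move=> [s' [t [E le_t q]]] le_T QQ'.
by exists s', t; split=> //; [exact: leq_trans le_T | exact: QQ'].
Qed.

Lemma runs_cost c s T T' Q : runs c s T Q -> T <= T' -> runs c s T' Q.
Proof. by move=> run le_T; apply: runs_weaken run le_T _. Qed.

Lemma runs_seq c1 c2 s T1 T2 Q1 Q : runs c1 s T1 Q1 ->
  (forall s1, Q1 s1 -> runs c2 s1 T2 Q) -> runs (Seq c1 c2) s (T1 + T2) Q.
Proof.
move=> [s1 [t1 [E1 le1 q1]]] /(_ _ q1)[s2 [t2 [E2 le2 q2]]].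
by exists s2, (t1 + t2); split=> //; [exact: ExecSeq E1 E2 | lia].
Qed.

Lemma runs_loop_free c s T Q :
  loop_free c -> lcost c <= T -> Q (sem c s) -> runs c s T Q.
Proof.
move=> /(exec_sem s)[t E le_t] le_T q.
by exists (sem c s), t; split=> //; exact: leq_trans le_T.
Qed.

(** Framing works bank by bank: which banks a command may write is visible in its syntax, so
    specifications need mention only those. *)
Lemma exec_frame c s s' t : exec c s s' t ->
  (forall b, b \notin nwritten c -> nmem s' b = nmem s b) /\
  (forall b, b \notin rwritten c -> rmem s' b = rmem s b).
Proof.
elim=> {c s s' t}.
- by [].
- move=> s b a e; split=> //= b' ; rewrite inE => /negbTE nb.
  by apply/funext => i /=; rewrite nb.
- move=> s b a e; split=> //= b' ; rewrite inE => /negbTE nb.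
  by apply/funext => i /=; rewrite nb.
- move=> c1 c2 s s1 s2 t1 t2 _ [IH1 IH1'] _ [IH2 IH2'].
  by split=> b /=; rewrite mem_cat negb_or => /andP[? ?];
    rewrite ?IH2 ?IH1 ?IH2' ?IH1'.
- move=> s b c1 c2 s' t _ [IH IH'].
  by split=> b' /=; rewrite mem_cat negb_or => /andP[? ?];
    [apply: IH|apply: IH']; case: ifP.
- by [].
- move=> b c s s1 s2 t1 t2 _ _ [IH1 IH1'] _ [IH2 IH2'].
  by split=> b' /= nb; rewrite ?IH2 ?IH1 ?IH2' ?IH1'.
Qed.

Lemma runs_frame c s T Q : runs c s T Q ->
  runs c s T (fun s' => [/\ Q s',
    forall b, b \notin nwritten c -> nmem s' b = nmem s b &
    forall b, b \notin rwritten c -> rmem s' b = rmem s b]).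
Proof.
by move=> [s' [t [E le_t q]]]; exists s', t; case: (exec_frame E).
Qed.

(** The index of the invariant is fuel: every iteration uses one unit, and a true guard without fuel
    is contradictory. *)
Lemma runs_while (I : nat -> state R -> Prop) b c s r T :
  (forall r s, I r s -> beval s b ->
     exists2 r', r = r'.+1 & runs c s T (I r')) ->
  I r s ->
  runs (While b c) s (r.+1 * (bcost b + T).+1)
    (fun s' => ~~ beval s' b /\ exists r', I r' s').
Proof.
move=> step; elim: r s => [|r IH] s Is.
- case bs: (beval s b); first by case: (step _ _ Is bs).
  exists s, (bcost b).+1; split; [exact: ExecWhileFalse | lia |].
  by split; [rewrite bs | exists 0].
- case bs: (beval s b); last first.
    exists s, (bcost b).+1; split; [exact: ExecWhileFalse | lia |].
    by split; [rewrite bs | exists r.+1].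
  case: (step _ _ Is bs) => _ [<-] [s1 [t1 [E1 le1 /IH]]].
  move=> [s2 [t2 [E2 le2 q2]]].
  exists s2, (bcost b + t1 + t2).+1; split=> //; last by lia.
  exact: ExecWhileTrue E1 E2.
Qed.

Definition set_reg s b v := State (update (nmem s) b 0 v) (rmem s).

(** The invariant receives the number of finished iterations as its index and must not depend on the
    counter cell itself, because the counter is incremented after the body has established the next
    instance. *)
Lemma runs_for (I : nat -> state R -> Prop) kb e body s N T :
  (forall k s v, I k s -> I k (set_reg s kb v)) ->
  (forall k s, I k s -> neval s e = N) ->
  kb \notin nwritten body ->
  (forall k s, k < N -> nmem s kb 0 = k -> I k s ->
     runs body s T (I k.+1)) ->
  I 0 s ->
  runs (for_loop kb e body) s ((T + ncost e + 20) * N.+1) (I N).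
Proof.
move=> stable bound kb_body step I0.
(* The fuel is the number of iterations left. *)
pose J r s := [/\ I (N - r) s, nmem s kb 0 = N - r & r <= N].
have J0 : J N (sem (nset kb (NConst 0)) s).
  by rewrite /J subnn; split=> //=; [exact: stable | rewrite eqxx].
apply: runs_weaken.
- apply: (runs_seq (T1 := 3) (Q1 := J N)); first exact: runs_loop_free.
  move=> s1 J1; apply: (runs_while (I := J) (T := T + 6)) J1.
  move=> r s2 [I2 k2 le_r] /=; rewrite k2 (bound _ _ I2) => lt_k.
  case: r => [|r] in I2 k2 le_r lt_k *; first lia.
  have lt_k' : N - r.+1 < N by lia.
  exists r => //; have /runs_frame run := step _ _ lt_k' k2 I2.
  apply: runs_seq run _ => s3 [I3 fr _].
  apply: runs_loop_free => //=; split=> /=.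
  + have -> : N - r = (N - r.+1).+1 by lia.
    exact: stable I3.
  + by rewrite !eqxx (fr _ kb_body) k2 /=; lia.
  + lia.
- rewrite /=; nia.
- move=> s' [nb [r [Is ks le_r]]]; have := nb.
  by rewrite /= ks (bound _ _ Is) => ?; have <- : N - r = N by lia.
Qed.

End Runs.

(** * Merge sort *)

Definition upd (b : nat -> nat) k v := fun x => if x == k then v else b x.

Section Merge.
Variables (le : rel nat) (n : nat).
Hypotheses (le_total : total le) (le_trans : transitive le).

Definition block_sorted (w : nat) (a : nat -> nat) :=
  forall m p q, m * w <= p -> p <= q -> q < m.+1 * w -> q < n -> le (a p) (a q).

(** Multisets are compared through occurrence counts on index ranges, which concatenate easily
    during a merge; [perm_of_occ] converts back to permutations. *)
Definition occ (a : nat -> nat) lo hi v := \sum_(lo <= p < hi) (a p == v).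

Lemma occ_recr a lo hi v : lo <= hi ->
  occ a lo hi.+1 v = occ a lo hi v + (a hi == v).
Proof. by move=> le_lo; rewrite /occ big_nat_recr. Qed.

Lemma occ_upd b k x v : occ (upd b k x) 0 k v = occ b 0 k v.
Proof.
by apply: eq_big_nat => p /andP[_ lt_p]; rewrite /upd (ltn_eqF lt_p).
Qed.

Lemma block_unique m m' w k : m * w <= k -> k < m.+1 * w ->
  m' * w <= k -> k < m'.+1 * w -> m = m'.
Proof.
move=> *; have ? : m < m'.+1 by rewrite -(ltn_pmul2r (m := w)); nia.
have ? : m' < m.+1 by rewrite -(ltn_pmul2r (m := w)); nia.
lia.
Qed.

(* The block [lo, hi) of [a] is being merged into [b]: of its two sorted halves
   [lo, mid) and [mid, hi), the parts [lo, i) and [mid, j) have been copied. *)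
Record merging w (a b : nat -> nat) k i mid j hi lo m : Prop := Merging {
  mg_lo : lo = m * (w + w);
  mg_i : lo <= i <= mid;
  mg_j : mid <= j <= hi;
  mg_hi : hi <= n;
  mg_k : k + mid = i + j;
  mg_mid : mid <= lo + w;
  mg_mid' : mid < hi -> mid = lo + w;
  mg_hi' : hi <= lo + (w + w);
  mg_next : hi = n \/ exists m', hi = m' * (w + w);
  mg_sorted : forall m' p q, m' * (w + w) <= p -> p <= q ->
    q < m'.+1 * (w + w) -> q < k -> le (b p) (b q);
  mg_below : forall p q, lo <= p -> p < k ->
    i <= q < mid \/ j <= q < hi -> le (b p) (a q);
  mg_occ : forall v, occ b 0 k v = occ a 0 i v + occ a mid j v
}.

Lemma merging_init w a b : merging w a b 0 0 0 0 0 0 0.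
Proof. by split=> //; [right; exists 0 | move=> v; rewrite /occ !big_geq]. Qed.

(** Once a block is exhausted, its copied items are exactly those below [hi], and the next pair of
    halves, cut off at [n], can be opened. *)
Lemma merging_block w a b k i mid j hi lo m : 0 < w ->
  merging w a b k i mid j hi lo m -> hi <= k -> k < n ->
  exists m', merging w a b k k (minn n (k + w)) (minn n (k + w))
    (minn n (k + (w + w))) k m'.
Proof.
move=> w0 [lo_m i_b j_b hi_n k_b mid_b mid_b' hi_b nxt srt blw cnt] hik kn.
have [ei ej ek] : [/\ i = mid, j = hi & k = hi] by split; lia.
case: nxt => [|[m' hi_m']]; first lia.
exists m'; split=> //; try lia.
- case: (leqP n (k + (w + w))) => [|_]; first by left.
  by right; exists m'.+1; lia.
- move=> v; rewrite cnt ei ej ek [X in _ = _ + X]/occ [X in _ = _ + X]big_geq //.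
  by rewrite addn0 /occ -big_cat_nat //=; lia.
Qed.

Lemma merging_left w a b k i mid j hi lo m : 0 < w -> block_sorted w a ->
  merging w a b k i mid j hi lo m -> i < mid ->
  (hi <= j \/ le (a i) (a j)) ->
  merging w a (upd b k (a i)) k.+1 i.+1 mid j hi lo m.
Proof.
move=> w0 sa [lo_m i_b j_b hi_n k_b mid_b mid_b' hi_b nxt srt blw cnt] imid le_ij.
(* The copied item is a least one among those left. The halves are the blocks of width [w] numbered
   [2m] and [2m + 1]; the other half is reached through [a j]. *)
have ai q : i <= q < mid \/ j <= q < hi -> le (a i) (a q).
  case=> /andP[q1 q2]; first by apply: (sa (m + m)); nia.
  case: le_ij => [|le_ij]; first lia.
  by apply: (le_trans le_ij); apply: (sa (m + m).+1); nia.
split=> //; try lia.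
- move=> m' p q p1 pq q1 q2; rewrite /upd.
  case: eqVneq => [pk|pk].
    case: eqVneq => [_|]; last lia.
    by have := le_total (a i) (a i); case/orP.
  case: eqVneq => [eq|qk]; last by apply: (srt m' p q) => //; lia.
  (* The new cell [k] lies in the current block, so only that block has a new sortedness
     condition. *)
  have ? : m' = m by apply: (@block_unique _ _ (w + w) k); nia.
  by apply: blw; lia.
- move=> p q p1 p2 q1; rewrite /upd; case: eqVneq => [_|pk].
    by apply: ai; lia.
  by apply: blw; lia.
- move=> v; rewrite occ_recr // occ_upd cnt [X in _ = X + _]occ_recr //.
  by rewrite /upd eqxx addnAC.
Qed.

Lemma merging_right w a b k i mid j hi lo m : 0 < w -> block_sorted w a ->
  merging w a b k i mid j hi lo m -> j < hi ->
  (mid <= i \/ le (a j) (a i)) ->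
  merging w a (upd b k (a j)) k.+1 i mid j.+1 hi lo m.
Proof.
move=> w0 sa [lo_m i_b j_b hi_n k_b mid_b mid_b' hi_b nxt srt blw cnt] jhi le_ij.
have aj q : i <= q < mid \/ j <= q < hi -> le (a j) (a q).
  case=> /andP[q1 q2]; last by apply: (sa (m + m).+1); nia.
  case: le_ij => [|le_ij]; first lia.
  by apply: (le_trans le_ij); apply: (sa (m + m)); nia.
split=> //; try lia.
- move=> m' p q p1 pq q1 q2; rewrite /upd.
  case: eqVneq => [pk|pk].
    case: eqVneq => [_|]; last lia.
    by have := le_total (a j) (a j); case/orP.
  case: eqVneq => [eq|qk]; last by apply: (srt m' p q) => //; lia.
  have ? : m' = m by apply: (@block_unique _ _ (w + w) k); nia.
  by apply: blw; lia.
- move=> p q p1 p2 q1; rewrite /upd; case: eqVneq => [_|pk].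
    by apply: aj; lia.
  by apply: blw; lia.
- move=> v; rewrite occ_recr // occ_upd cnt [X in _ = _ + X]occ_recr; last lia.
  by rewrite /upd eqxx addnA.
Qed.

Lemma merging_done w a b i mid j hi lo m : merging w a b n i mid j hi lo m ->
  block_sorted (w + w) b /\ forall v, occ b 0 n v = occ a 0 n v.
Proof.
move=> [lo_m i_b j_b hi_n k_b mid_b mid_b' hi_b nxt srt blw cnt]; split.
  by move=> m' p q *; apply: (srt m').
move=> v; rewrite cnt.
have [-> -> ->] : [/\ i = mid, j = hi & hi = n] by split; lia.
by rewrite /occ -big_cat_nat //=; lia.
Qed.

End Merge.

Lemma perm_of_occ n a a' : (forall v, occ a 0 n v = occ a' 0 n v) ->
  perm_eq (mkseq a n) (mkseq a' n).
Proof.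
have cntE f v : occ f 0 n v = count_mem v (mkseq f n).
  rewrite /occ /mkseq count_map -sum1_count [RHS]big_mkcond /= /index_iota subn0.
  by apply: eq_bigr => i _; case: eqP.
by move=> H; apply/allP => v _ /=; rewrite -!cntE H.
Qed.

Definition bor (b1 b2 : bexpr) : bexpr := BNot (BAnd (BNot b1) (BNot b2)).
Definition rlt (e1 e2 : rexpr) : bexpr := BNot (RLe e2 e1).

Definition lex_le (C K D : nat) (i j : nexpr) : bexpr :=
  bor (rlt (RLoad C i) (RLoad C j))
    (BAnd (RLe (RLoad C i) (RLoad C j))
       (bor (rlt (RLoad K i) (RLoad K j))
          (BAnd (RLe (RLoad K i) (RLoad K j)) (RLe (RLoad D j) (RLoad D i))))).

Definition lexle (R : realType) (c k d : nat -> R) (i j : nat) : bool :=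
  ((c i < c j) || (c i <= c j) &&
    ((k i < k j) || (k i <= k j) && (d j <= d i)))%R.

(** Correct because subtraction is truncated. *)
Definition nmin (e1 e2 : nexpr) : nexpr := NSub e1 (NSub e1 e2).

(* Natural-number registers: 10 = k, 11 = i, 12 = mid, 13 = j, 14 = hi,
   15 = width; bank 2 is the array to be sorted and bank 3 is scratch space. *)
Definition merge_setup : cmd :=
  If (NLe (reg 14) (reg 10))
    (Seq (nset 11 (reg 10))
    (Seq (nset 12 (nmin (reg 0) (NAdd (reg 10) (reg 15))))
    (Seq (nset 13 (reg 12))
         (nset 14 (nmin (reg 0)
            (NAdd (reg 10) (NAdd (reg 15) (reg 15))))))))
    Skip.

Definition merge_step (C K D : nat) : cmd :=
  If (BAnd (NLe (NAdd (reg 11) (NConst 1)) (reg 12))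
        (bor (NLe (reg 14) (reg 13))
             (lex_le C K D (NLoad 2 (reg 11)) (NLoad 2 (reg 13)))))
    (Seq (NStore 3 (reg 10) (NLoad 2 (reg 11)))
         (nset 11 (NAdd (reg 11) (NConst 1))))
    (Seq (NStore 3 (reg 10) (NLoad 2 (reg 13)))
         (nset 13 (NAdd (reg 13) (NConst 1)))).

Definition merge_pass (C K D : nat) : cmd :=
  Seq (Seq (Seq (nset 11 (NConst 0)) (nset 12 (NConst 0)))
           (Seq (nset 13 (NConst 0)) (nset 14 (NConst 0))))
  (Seq (for_loop 10 (reg 0) (Seq merge_setup (merge_step C K D)))
  (Seq (for_loop 10 (reg 0) (NStore 2 (reg 10) (NLoad 3 (reg 10))))
       (nset 15 (NAdd (reg 15) (reg 15))))).

Definition merge_sort (C K D : nat) : cmd :=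
  Seq (nset 15 (NConst 1))
    (While (NLe (NAdd (reg 15) (NConst 1)) (reg 0)) (merge_pass C K D)).

(** The successors let this bound absorb linear and constant costs even for [n = 0]. *)
Definition nlogn (n : nat) : nat := n.+1 * (up_log 2 n).+1.

Lemma leq_nlogn n : n.+1 <= nlogn n.
Proof. by rewrite leq_pmulr. Qed.

Section Sort.
Variable R : realType.
Implicit Type s : state R.

Lemma beval_bor s b1 b2 : beval s (bor b1 b2) = beval s b1 || beval s b2.
Proof. by rewrite /= negb_and !negbK. Qed.

Lemma beval_rlt s e1 e2 : beval s (rlt e1 e2) = (reval s e1 < reval s e2)%R.
Proof. by rewrite /= -real_ltNge ?num_real. Qed.

Lemma beval_band s b1 b2 : beval s (BAnd b1 b2) = beval s b1 && beval s b2.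
Proof. by []. Qed.

Lemma sem_if s b c1 c2 :
  sem (If b c1 c2) s = if beval s b then sem c1 s else sem c2 s.
Proof. by []. Qed.

Lemma beval_lex_le s C K D i j : beval s (lex_le C K D i j) =
  lexle (rmem s C) (rmem s K) (rmem s D) (neval s i) (neval s j).
Proof.
by rewrite /lex_le /lexle !(beval_bor, beval_band, beval_rlt).
Qed.

Lemma lexle_total (c k d : nat -> R) : total (lexle c k d).
Proof.
by move=> i j; rewrite /lexle; case: (ltgtP (c i) (c j)); case: (ltgtP (k i) (k j));
  rewrite //= => _ _; exact: le_total.
Qed.

Lemma lexle_trans (c k d : nat -> R) : transitive (lexle c k d).
Proof.
move=> j i l; rewrite /lexle => /orP[ij|/andP[ij ij']] /orP[jl|/andP[jl jl']].
- by rewrite (lt_trans ij jl).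
- by rewrite (lt_le_trans ij jl).
- by rewrite (le_lt_trans ij jl).
rewrite (le_trans ij jl) orbC /=; apply/orP; left.
case/orP: ij' => [{}ij|/andP[{}ij ij']]; case/orP: jl' => [{}jl|/andP[{}jl jl']].
- by rewrite (lt_trans ij jl).
- by rewrite (lt_le_trans ij jl).
- by rewrite (le_lt_trans ij jl).
by rewrite (le_trans ij jl) (le_trans jl' ij') orbT.
Qed.

Lemma merge_pass_runs (C K D : nat) : exists T, forall s n w,
  0 < w -> nmem s 0 0 = n -> nmem s 15 0 = w ->
  block_sorted (lexle (rmem s C) (rmem s K) (rmem s D)) n w (nmem s 2) ->
  runs (merge_pass C K D) s (T * n.+1) (fun s' =>
    [/\ rmem s' = rmem s, nmem s' 0 0 = n, nmem s' 15 0 = w + w,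
      block_sorted (lexle (rmem s C) (rmem s K) (rmem s D)) n (w + w)
        (nmem s' 2) &
      forall v, occ (nmem s' 2) 0 n v = occ (nmem s 2) 0 n v]).
Proof.
exists 1000=> s n w w0 sn sw srt; set r := rmem s in srt *.
set a := nmem s 2 in srt *; set le := lexle _ _ _ in srt *.
have le_tot : total le by exact: lexle_total.
have le_tr : transitive le by exact: lexle_trans.
(* [I] is the invariant of the merging loop and [I2] that of the loop copying the result back. *)
pose I x t := [/\ rmem t = r, nmem t 0 0 = n, nmem t 15 0 = w, nmem t 2 = a &
  exists lo m, merging le n w a (nmem t 3) x (nmem t 11 0) (nmem t 12 0)
    (nmem t 13 0) (nmem t 14 0) lo m].
pose I2 x t := [/\ rmem t = r, nmem t 0 0 = n, nmem t 15 0 = w,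
  block_sorted le n (w + w) (nmem t 3) /\
  (forall v, occ (nmem t 3) 0 n v = occ a 0 n v) &
  forall p, p < x -> nmem t 2 p = nmem t 3 p].
apply: runs_cost.
- apply: (runs_seq (Q1 := I 0)).
    apply: runs_loop_free => //=; split=> //=.
    by exists 0, 0; exact: merging_init.
  move=> s1 I1; apply: (runs_seq (Q1 := I2 0)).
    apply: runs_weaken; first apply: (runs_for (I := I) (N := n)) I1.
    - by move=> x t v.
    - by move=> x t [].
    - by [].
    - move=> x t lt_x tx [tr tn tw ta [lo [m M]]].
      (* After the setup the current block is not exhausted, so the step has an item to copy. *)
      apply: (runs_seq (Q1 := fun t => [/\ nmem t 10 0 = x, I x t &
        x < nmem t 14 0])).
        apply: runs_loop_free => //; rewrite /merge_setup sem_if.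
        have [hx|hx] : (nmem t 14 0 <= x) \/ x < nmem t 14 0 by lia.
          rewrite ifT; last by rewrite /= tx.
          have [m' M'] := merging_block w0 M hx lt_x.
          split; [by rewrite /= | split=> // | by rewrite /= tn tw tx; lia].
          exists x, m'; move: M'; rewrite !minnE /= tn tx tw.
          by [].
        rewrite ifF /=; last by rewrite tx; lia.
        by split=> //; split=> //; exists lo, m.
      move=> {lo m M}t1 [t1x [t1r t1n t1w t1a [lo [m M]]] hx].
      have [? ? ? ? ? _ _ _ _ _ _ _] := M.
      apply: runs_loop_free => //; rewrite /merge_step sem_if.
      rewrite beval_band beval_bor beval_lex_le /= t1a t1r -/le addn1.
      case: ifP => cond; split=> //=; exists lo, m; rewrite t1x ?addn1.
        by apply: merging_left => //; case/andP: cond => ? /orP.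
      apply: merging_right => //; first by move: cond; lia.
      have /orP := le_tot (a (nmem t1 11 0)) (a (nmem t1 13 0)).
      by move: cond; lia.
    - exact: leqnn.
    - move=> t [tr tn tw ta [lo [m M]]].
      by split=> //; exact: merging_done M.
  move=> s2 I2s; apply: (runs_seq (Q1 := I2 n)).
    apply: (runs_for (I := I2)) I2s.
    - by [].
    - by move=> x t [].
    - by [].
    - move=> x t lt_x tx [tr tn tw tb tp].
      apply: runs_loop_free => //; split=> //= p; rewrite tx.
      by case: eqVneq => [->//|px] ltp; apply: tp; lia.
  move=> s3 [s3r s3n s3w [s3s s3o] s3p].
  apply: runs_loop_free => //; split=> //=; first by rewrite s3w.
  - by move=> m p q p1 pq q1 q2; rewrite !s3p; try lia; exact: (s3s m).
  - move=> v; rewrite -s3o; apply: eq_big_nat => p /andP[_ lt_p].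
    by rewrite s3p.
- by rewrite /=; lia.
Qed.

Lemma merge_sort_runs (C K D : nat) : exists T, forall s n,
  nmem s 0 0 = n -> perm_eq (mkseq (nmem s 2) n) (iota 0 n) ->
  runs (merge_sort C K D) s (T * nlogn n) (fun s' =>
    perm_eq (mkseq (nmem s' 2) n) (iota 0 n) /\
    forall p q, p <= q -> q < n ->
      lexle (rmem s C) (rmem s K) (rmem s D) (nmem s' 2 p) (nmem s' 2 q)).
Proof.
have [T pass] := merge_pass_runs C K D.
exists (T + 20) => s n sn permA.
set le := lexle _ _ _.
(* The fuel [r] counts passes: each one doubles the width [w], and [n <= w * 2 ^ r] makes the guard
   false at [r = 0]. *)
pose I r t := exists w, [/\ rmem t = rmem s, nmem t 0 0 = n,
  nmem t 15 0 = w /\ 0 < w, n <= w * 2 ^ r &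
  block_sorted le n w (nmem t 2) /\
  (forall v, occ (nmem t 2) 0 n v = occ (nmem s 2) 0 n v)].
apply: runs_cost.
- apply: (runs_seq (T1 := 3) (Q1 := I (up_log 2 n))).
    apply: runs_loop_free => //; exists 1; split=> //=.
      by rewrite mul1n up_logP.
    split=> // m p q p1 pq q1 _; have -> : p = q by lia.
    by have /orP[] := lexle_total (rmem s C) (rmem s K) (rmem s D)
      (nmem s 2 q) (nmem s 2 q).
  move=> s1 I1; apply: runs_weaken.
  - apply: (runs_while (T := T * n.+1)) I1.
    move=> r t [w [tr tn [tw w0] le_n [srt occE]]].
    rewrite /= tw tn addn1 => lt_w.
    case: r le_n => [|r] le_n; first by move: le_n; rewrite expn0; lia.
    exists r => //; apply: (runs_weaken (pass t n w _ _ _ _)) => //.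
      by rewrite tr.
    move=> t' [t'r t'n t'w srt' occE']; exists (w + w); split=> //.
    + by rewrite t'r.
    + by split=> //; lia.
    + by move: le_n; rewrite expnS; lia.
    + by move: srt'; rewrite tr; split=> // v; rewrite occE'.
  - exact: leqnn.
  - move=> s' [nb [r [w [s'r s'n [s'w w0] le_n [srt occE]]]]].
    have {nb}le_nw : n <= w by move: nb; rewrite /= s'w s'n; lia.
    split; first exact: perm_trans (perm_of_occ occE) permA.
    by move=> p q pq qn; apply: (srt 0) => //; lia.
- have := leq_nlogn n; rewrite /nlogn /=; nia.
Qed.

End Sort.

(** * Greedy bucketing of a sorted sequence *)

Section Buckets.
Variable R : realType.
Local Open Scope ring_scope.

(* Buckets are numbered from 1 to [nb]; [e b] is the first item of bucket [b],
   and [id i] is the bucket of item [i]. *)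
Record bucketing (c k w : nat -> R) (D : seq nat) (nb : nat)
    (e id : nat -> nat) : Prop := Bucketing {
  bk_id : forall i, i \in D -> (0 < id i <= nb)%N;
  bk_class : forall i, i \in D -> c (e (id i)) = c i;
  bk_range : forall i, i \in D ->
    k (e (id i)) <= k i < k (e (id i)) + w (e (id i));
  bk_first : forall b, (0 < b <= nb)%N -> e b \in D;
  bk_firstK : forall b, (0 < b <= nb)%N -> id (e b) = b;
  bk_next : forall b, (0 < b < nb)%N -> c (e b) < c (e b.+1) \/
    c (e b) = c (e b.+1) /\ k (e b) + w (e b) <= k (e b.+1)
}.

Variables (c k w : nat -> R).

(** Only consecutive buckets are compared in [bk_next], so comparing with the last first item
    suffices; a positive width puts [i] into the range of its own bucket. *)
Lemma bucketing_new D nb e id i : bucketing c k w D nb e id -> i \notin D ->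
  0 < w i ->
  ((0 < nb)%N -> c (e nb) < c i \/ c (e nb) = c i /\ k (e nb) + w (e nb) <= k i) ->
  bucketing c k w (rcons D i) nb.+1 (upd e nb.+1 i) (upd id i nb.+1).
Proof.
move=> [h1 h2 h3 h4 h5 h6] iD wi next.
have idN x : x \in D -> (x == i = false) * ((id x == nb.+1) = false).
  move=> xD; split; first by apply/negbTE; apply: contraNneq iD => <-.
  by have := h1 _ xD; lia.
split=> [x|x|x|b b_b|b b_b|b b_b]; rewrite ?mem_rcons ?inE.
- case/predU1P=> [->|xD]; rewrite /upd ?eqxx ?idN //; first lia.
  by have := h1 _ xD; lia.
- case/predU1P=> [->|xD]; rewrite /upd ?eqxx ?idN //; exact: h2.
- case/predU1P=> [->|xD]; rewrite /upd ?eqxx ?idN //; last exact: h3.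
  by rewrite lexx ltrDl.
- rewrite /upd; case: (eqVneq b nb.+1) => [_|nb_b]; first by rewrite eqxx.
  by rewrite h4 ?orbT //; lia.
- rewrite /upd; case: (eqVneq b nb.+1) => [->|nb_b]; first by rewrite eqxx.
  have b_b' : (0 < b <= nb)%N by lia.
  by rewrite idN ?h4 ?h5.
- rewrite /upd [b == _]ltn_eqF; last by case/andP: b_b.
  rewrite eqSS; case: eqVneq => [->|nb_b]; first by apply: next; lia.
  by apply: h6; lia.
Qed.

Lemma bucketing_old D nb e id i : bucketing c k w D nb e id -> i \notin D ->
  (0 < nb)%N -> c (e nb) = c i -> k (e nb) <= k i < k (e nb) + w (e nb) ->
  bucketing c k w (rcons D i) nb e (upd id i nb).
Proof.
move=> [h1 h2 h3 h4 h5 h6] iD nb0 ci ki.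
have idN x : x \in D -> (x == i = false).
  by move=> xD; apply/negbTE; apply: contraNneq iD => <-.
split=> [x|x|x|b b_b|b b_b|b b_b]; rewrite ?mem_rcons ?inE.
- case/predU1P=> [->|xD]; rewrite /upd ?eqxx ?idN //; first lia.
  exact: h1.
- case/predU1P=> [->|xD]; rewrite /upd ?eqxx ?idN //; exact: h2.
- case/predU1P=> [->|xD]; rewrite /upd ?eqxx ?idN //; exact: h3.
- by rewrite h4 ?orbT.
- by rewrite /upd idN ?h4 ?h5.
- exact: h6.
Qed.

Lemma bucketing_mem D D' nb e id : D =i D' ->
  bucketing c k w D nb e id -> bucketing c k w D' nb e id.
Proof.
move=> DD' [h1 h2 h3 h4 h5 h6].
by split=> // [x|x|x|b ?]; rewrite -DD'; auto.
Qed.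

End Buckets.

(* Registers: 11 = current item, 19 = number of buckets; real cells (1, 0) and
   (2, 0) = number of buckets and its residue modulo 3; bank 18 = first items. *)
Definition bucket_find (C K W : nat) : cmd :=
  let first := NLoad 18 (reg 19) in
  Seq (nset 11 (NLoad 2 (reg 10)))
    (If (bor (NLe (reg 10) (NConst 0))
          (bor (rlt (RLoad C first) (RLoad C (reg 11)))
               (RLe (RAdd (RLoad K first) (RLoad W first))
                    (RLoad K (reg 11)))))
      (Seq (nset 19 (NAdd (reg 19) (NConst 1)))
      (Seq (NStore 18 (reg 19) (reg 11))
      (Seq (RStore 1 (NConst 0) (RAdd (RLoad 1 (NConst 0)) (RConst 1)))
           (If (RLe (RConst 2) (RLoad 2 (NConst 0)))
              (RStore 2 (NConst 0) (RConst 0))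
              (RStore 2 (NConst 0) (RAdd (RLoad 2 (NConst 0)) (RConst 1)))))))
      Skip).

(** The number, its residue and the key of the first item are stored as reals because later stages
    use them as classes, keys or widths. Counters provide them, since the machine neither converts
    naturals to reals nor divides naturals. *)
Definition bucket_write (K o : nat) : cmd :=
  Seq (NStore 9 (reg 11) (reg 19))
  (Seq (RStore o (reg 11) (RLoad 1 (NConst 0)))
  (Seq (RStore o.+1 (reg 11) (RLoad 2 (NConst 0)))
       (RStore o.+2 (reg 11) (RLoad K (NLoad 18 (reg 19)))))).

(* Bank 6 is never written: it serves as a constant key. *)
Definition bucket (C K W o : nat) : cmd :=
  Seq (merge_sort C K 6)
  (Seq (Seq (nset 19 (NConst 0))
       (Seq (RStore 1 (NConst 0) (RConst 0)) (RStore 2 (NConst 0) (RConst 0))))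
       (for_loop 10 (reg 0) (Seq (bucket_find C K W) (bucket_write K o)))).

Section BucketRuns.
Variable R : realType.
Implicit Type s : state R.

Definition bucket_post (c k w : nat -> R) n o s nb e id : Prop :=
  [/\ bucketing c k w (iota 0 n) nb e id,
   forall i, i < n -> nmem s 9 i = id i,
   forall i, i < n -> rmem s o i = (id i)%:R%R,
   forall i, i < n -> rmem s o.+1 i = (id i %% 3)%:R%R &
   forall i, i < n -> rmem s o.+2 i = k (e (id i))].

Lemma sem_seq c1 c2 s : sem (Seq c1 c2) s = sem c2 (sem c1 s).
Proof. by []. Qed.

Lemma sem_if_rstore s b B a e1 e2 : sem (If b (RStore B a e1) (RStore B a e2)) s =
  State (nmem s)
    (update (rmem s) B (neval s a) (if beval s b then reval s e1 else reval s e2)).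
Proof. by rewrite sem_if; case: ifP. Qed.

Lemma bucket_runs (C K W o : nat) :
  2 < C < o -> 2 < K < o -> 2 < W < o ->
  exists T, forall s n,
    nmem s 0 0 = n -> perm_eq (mkseq (nmem s 2) n) (iota 0 n) ->
    (forall i, i < n -> (0 < rmem s W i)%R) ->
    runs (bucket C K W o) s (T * nlogn n) (fun s' =>
      perm_eq (mkseq (nmem s' 2) n) (iota 0 n) /\
      exists nb e id,
        bucket_post (rmem s C) (rmem s K) (rmem s W) n o s' nb e id).
Proof.
move=> C_o K_o W_o; have [T sort] := merge_sort_runs R C K 6.
exists (T + 1000) => s n sn permA Wpos.
set c := rmem s C; set k := rmem s K; set w := rmem s W in Wpos *.
have := sort s n sn permA => /runs_frame sort_run.
apply: runs_cost; first apply: runs_seq sort_run _.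
move=> s1 [[]]; set P := nmem s1 2 => permP sortP fr1n fr1r.
have s1n : nmem s1 0 0 = n by rewrite fr1n.
have uniqP : uniq (mkseq P n) by rewrite (perm_uniq permP) iota_uniq.
have PinD x y : x < y -> P x \in mkseq P y by move=> ?; rewrite map_f ?mem_iota.
have PninD x : x < n -> P x \notin mkseq P x.
  move=> lt_x; have : uniq (mkseq P x.+1).
    apply: subseq_uniq uniqP; rewrite /mkseq map_subseq //.
    by rewrite -(subnKC lt_x) iotaD prefix_subseq.
  by rewrite mkseqS rcons_uniq => /andP[].
have Pn x : x < n -> P x < n.
  by move=> /PinD; rewrite (perm_mem permP) mem_iota.
pose old t b := b \notin [:: 1; 2; o; o.+1; o.+2] -> rmem t b = rmem s b.
(* The bucket map is a parameter because between [bucket_find] and [bucket_write] the current item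
   is already assigned a bucket while bank 9 does not show it yet. *)
pose B x t (id : nat -> nat) :=
  [/\ bucketing c k w (mkseq P x) (nmem t 19 0) (nmem t 18) id,
    rmem t 1 0 = (nmem t 19 0)%:R%R, rmem t 2 0 = (nmem t 19 0 %% 3)%:R%R,
    nmem t 0 0 = n /\ nmem t 2 = P & forall b, old t b].
pose O x t := forall i, i \in mkseq P x -> let b := nmem t 9 i in
  [/\ b <= nmem t 19 0, rmem t o i = b%:R%R, rmem t o.+1 i = (b %% 3)%:R%R &
    rmem t o.+2 i = k (nmem t 18 b)].
pose I x t := B x t (nmem t 9) /\ O x t.
have oldC t : (forall b, old t b) -> [/\ rmem t C = c, rmem t K = k & rmem t W = w].
  by move=> H; split; apply: H; rewrite !inE; lia.
have o0 : (o == 0) = false by lia.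
have o1 : (o == 1) = false by lia.
have o2 : (o == 2) = false by lia.
have o0' : (0 == o) = false by lia.
have o1' : (1 == o) = false by lia.
have o2' : (2 == o) = false by lia.
have k1 : (K == o) = false by lia.
have k2 : (K == o.+1) = false by lia.
have oo1 : (o == o.+1) = false by lia.
have oo2 : (o == o.+2) = false by lia.
have oo3 : (o.+1 == o.+2) = false by lia.
apply: runs_seq.
  apply: (runs_loop_free (Q := I 0)) => //.
  split=> //; split=> //=; last first.
    move=> b; rewrite /old !inE /= => nb.
    have [b1 b2] : (b == 1) = false /\ (b == 2) = false by lia.
    by apply/funext => i /=; rewrite b1 b2 fr1r.
  by split=> // b; lia.
move=> s2 I2.
apply: runs_weaken; first apply: (runs_for (I := I) (N := n)) I2.
- by move=> x t v.
- by move=> x t [[_ _ _ []]].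
- by [].
- move=> x t lt_x tx [[tB t1 t2 [tn tP] told] tO].
  have [tC tK tW] := oldC _ told.
  apply: (runs_seq (Q1 := fun t' => [/\ nmem t' 11 0 = P x, O x t' &
    B x.+1 t' (upd (nmem t' 9) (P x) (nmem t' 19 0))])).
    apply: (runs_seq (Q1 := fun ta => ta = sem (nset 11 (NLoad 2 (reg 10))) t)).
      exact: runs_loop_free.
    move=> _ ->; apply: runs_loop_free => //.
    rewrite sem_if !beval_bor beval_rlt !sem_seq sem_if_rstore /= tC tK tW tx tP.
    set nb := nmem t 19 0 in tB t1 t2 tO *; set e := nmem t 18 in tB tO *.
    have x_nb : 0 < x -> 0 < nb.
      by move=> /PinD /(bk_id tB); lia.
    (* The first item of the last bucket comes earlier in the sorted order, so the test of the
       program needs to look in one direction only. *)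
    have sorted_nb : 0 < nb -> ((c (e nb) < c (P x)) || (c (e nb) <= c (P x)) &&
        (k (e nb) <= k (P x)))%R.
      move=> nb0; have /mapP[p] : e nb \in mkseq P x by apply: (bk_first tB); lia.
      rewrite mem_iota => /andP[_ lt_p] ->; have := sortP p x.
      rewrite /lexle => /(_ (ltnW lt_p) lt_x) /orP[->//|/andP[-> /orP[/ltW ->|/andP[-> _]]]];
        by rewrite orbT.
    case: ifP => cond.
      split=> // [i iD|] /=; first rewrite !(eqSS, o0, o1, o2) /=.
        have [b1 b2 b3 b4] := tO i iD; split=> //; first lia.
        by rewrite [_ == nb + 1]ltn_eqF //; lia.
      split=> /=.
      + rewrite mkseqS addn1; apply: bucketing_new => //; [exact: PninD|exact/Wpos/Pn|].
        move=> nb0; have x0 : 0 < x by case: (x) tB => // /bk_first /(_ nb);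
          rewrite leqnn nb0 => /(_ isT).
        move: cond; rewrite leqn0 gtn_eqF //=.
        case/orP: (sorted_nb nb0) => [->|/andP[le_c le_k]]; first by left.
        by case: ltgtP le_c => // [_ _ _|-> _ /= cond]; [left|right].
      + by rewrite t1 natrD.
      + rewrite t2 addn1 -[2%R]/(2%:R)%R ler_nat.
        have [m3|m3] : nb %% 3 = 2 \/ nb %% 3 < 2 by lia.
          by rewrite (_ : nb.+1 %% 3 = 0) ?m3; last lia.
        rewrite leqNgt m3 /= (_ : nb.+1 %% 3 = (nb %% 3).+1); last lia.
        by rewrite natr1.
      + by [].
      + move=> b nb_b; rewrite -told //; move: nb_b; rewrite !inE => nb_b.
        have [b1 b2] : (b == 1) = false /\ (b == 2) = false by lia.
        by apply/funext => i /=; rewrite b1 b2.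
    split=> //=; split=> //.
    move/negbT: cond; rewrite !negb_or -ltnNge => /and3P[x0].
    rewrite -leNgt -ltNge => le_c lt_k.
    have nb0 := x_nb x0.
    rewrite mkseqS; apply: bucketing_old => //; first exact: PninD.
      case/orP: (sorted_nb nb0) => [lt_c|/andP[le_c' _]].
        by move: le_c; rewrite leNgt lt_c.
      by apply/eqP; rewrite eq_le le_c le_c'.
    rewrite lt_k andbT; case/orP: (sorted_nb nb0) => [lt_c|/andP[//]].
    by move: le_c; rewrite leNgt lt_c.
  move=> {tB t1 t2 tn tP told tO tC tK tW}t' [tx' tO [tB t1 t2 [tn tP] told]].
  have [tC tK tW] := oldC _ told.
  have eqs := (eqSS, o0, o1, o2, o0', o1', o2', k1, k2, oo1, oo2, oo3).
  apply: runs_loop_free => //=; rewrite tx'; split; first split=> //=.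
  + by rewrite !eqs.
  + by rewrite !eqs.
  + move=> b nb_b; rewrite -told //; move: nb_b; rewrite !inE => nb_b.
    have b1 : (b == o) = false by lia.
    have b2 : (b == o.+1) = false by lia.
    have b3 : (b == o.+2) = false by lia.
    by apply/funext => i /=; rewrite b1 b2 b3.
  + move=> i; rewrite mkseqS mem_rcons inE => iD /=.
    rewrite !eqs !eqxx /= tK.
    case: eqVneq iD => [-> _|_ /= iD]; last by rewrite !andbF; exact: tO.
    by split=> //; rewrite ?t1 ?t2.
- exact: leqnn.
- move=> t [[tB t1 t2 [tn tP] told] tO].
  have mem_n i : (i \in mkseq P n) = (i \in iota 0 n) by rewrite (perm_mem permP).
  have iD i : i < n -> i \in mkseq P n by rewrite mem_n mem_iota.
  split; first by rewrite tP.
  exists (nmem t 19 0), (nmem t 18), (nmem t 9).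
  by split=> // [|i /iD /tO[]|i /iD /tO[]|i /iD /tO[]] //; apply: bucketing_mem tB.
- have := leq_nlogn n; rewrite /nlogn /=; nia.
Qed.

End BucketRuns.

(** * Longest chains by patience sorting *)

Section Piles.
Variable lt : rel nat.
Hypotheses (lt_irr : irreflexive lt) (lt_trans : transitive lt).
Hypothesis lt_negtrans : forall p q r, ~~ lt p q -> ~~ lt q r -> ~~ lt p r.

(* Patience sorting of the positions below [x]: [rank p + 1] is the length of a
   longest chain ending at [p], and [tail r] is an [lt]-least position of rank
   [r]. *)
Record piles x m (tail pred rank : nat -> nat) : Prop := Piles {
  pl_le : m <= x;
  pl_tail : forall r, r < m -> tail r < x /\ rank (tail r) = r;
  pl_incr : forall r r', r < r' -> r' < m -> lt (tail r) (tail r');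
  pl_rank : forall p, p < x -> rank p < m /\ ~~ lt p (tail (rank p));
  pl_chain : forall p q, p < q -> q < x -> lt p q -> rank p < rank q;
  pl_pred : forall p, p < x -> 0 < rank p ->
    [/\ pred p < p, lt (pred p) p & rank (pred p) = (rank p).-1]
}.

(** The position [x] goes on the first pile whose tail is not below it. Negative transitivity
    carries comparisons from a tail to all positions of the same rank. *)
Lemma piles_step x m tail pred rank lo : piles x m tail pred rank -> lo <= m ->
  (forall r, r < lo -> lt (tail r) x) ->
  (forall r, lo <= r < m -> ~~ lt (tail r) x) ->
  piles x.+1 (if m <= lo then m.+1 else m) (upd tail lo x)
    (upd pred x (tail lo.-1)) (upd rank x lo).
Proof.
move=> [h0 h1 h2 h3 h4 h5] lo_m below above.
set m' := if _ then _ else _.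
have m'P r : r < m' -> r = lo \/ r < m by rewrite /m'; case: ifP; lia.
have lo_m' : lo < m' by rewrite /m'; case: ifP; lia.
have m_m' : m <= m' by rewrite /m'; case: ifP; lia.
split; rewrite /upd.
- by rewrite /m'; case: ifP; lia.
- move=> r /m'P; case: (eqVneq r lo) => [-> _|r_lo [eq|rm]].
  + by rewrite eqxx.
  + by rewrite eq eqxx in r_lo.
  + by have [tx tr] := h1 _ rm; rewrite (ltn_eqF tx); split=> //; lia.
- move=> r r' rr' /m'P; case: (eqVneq r' lo) => [r'lo _|r'lo [eq|r'm]].
  + by rewrite (ltn_eqF (_ : r < lo)) -?r'lo //; apply: below; rewrite -r'lo.
  + by rewrite eq eqxx in r'lo.
  case: (eqVneq r lo) => [rlo|_]; last exact: h2.
  apply: contraT => n1; have lor : lo <= lo < m by lia.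
  (* Otherwise the old tails of the piles [lo] and [r'] would not be increasing. *)
  by have := lt_negtrans (above _ lor) n1; rewrite h2 // -?rlo.
- move=> p; rewrite ltnS leq_eqVlt; case: (eqVneq p x) => [-> _|_ /= px].
    by rewrite eqxx lt_irr.
  have [rm np] := h3 _ px; split; first exact: leq_trans m_m'.
  case: (eqVneq (rank p) lo) => [eq|//]; apply: lt_negtrans np _.
  by apply: above; lia.
- move=> p q pq; rewrite ltnS leq_eqVlt; case: (eqVneq q x) => [eq _|_ /= qx].
    rewrite eq in pq *; rewrite (ltn_eqF pq) => px.
    have [rm np] := h3 _ pq; rewrite ltnNge; apply/negP => lor.
    have lor' : lo <= rank p < m by rewrite lor.
    (* A position of rank at least [lo] is not below its tail, which is not below [x]. *)
    by have := lt_negtrans np (above _ lor'); rewrite px.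
  by rewrite ltn_eqF; [exact: h4 | lia].
- move=> p; rewrite ltnS leq_eqVlt; case: (eqVneq p x) => [-> _ lo0|_ /= px rp].
    have lo1 : lo.-1 < m by lia.
    have [tx tr] := h1 _ lo1.
    by rewrite (ltn_eqF tx); split=> //; apply: below; lia.
  have [pp lp rp'] := h5 _ px rp.
  by rewrite ltn_eqF; [split | lia].
Qed.

Lemma pile_search x m tail pred rank mid : piles x m tail pred rank -> mid < m ->
  if lt (tail mid) x then forall r, r <= mid -> lt (tail r) x
  else forall r, mid <= r < m -> ~~ lt (tail r) x.
Proof.
move=> H mid_m; case: ifP => [lt_mid r r_mid|/negbT lt_mid r /andP[mid_r r_m]].
  case: (ltngtP r mid) r_mid => // [r_mid|->] // _.
  exact: lt_trans (pl_incr H r_mid mid_m) lt_mid.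
case: (ltngtP mid r) mid_r => // [mid_r|<-] // _.
by apply: contra lt_mid; exact: lt_trans (pl_incr H mid_r r_m).
Qed.

(** The chain is read backwards along predecessor links from the tail of the last pile. *)
Definition chain_of (m : nat) (tail pred : nat -> nat) : seq nat :=
  [seq iter t pred (tail m.-1) | t <- iota 0 m].

Lemma chain_ofP x m tail pred rank : piles x m tail pred rank ->
  let u t := iter t pred (tail m.-1) in
  (forall t, t < m -> u t < x) /\
  (forall t t', t < t' -> t' < m -> u t' < u t /\ lt (u t') (u t)).
Proof.
move=> H u.
(* Each link lowers the rank by one, so the [m] positions visited all have a valid predecessor
   except the last, of rank 0. *)
have uP t : t < m -> u t < x /\ rank (u t) = m.-1 - t.
  elim: t => [|t IH] tm; first by rewrite subn0; apply: (pl_tail H); lia.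
  have [ux ru] := IH (ltnW tm).
  have [|pu _ rpu] := pl_pred H ux; first by rewrite ru; lia.
  by split; [exact: ltn_trans ux | rewrite /u /= rpu ru; lia].
split=> [t /uP[] //|t t' tt' t'm].
have uS y : y.+1 < m -> u y.+1 < u y /\ lt (u y.+1) (u y).
  move=> ym; have [ux ru] := uP _ (ltnW ym).
  by have [|] := pl_pred H ux; first by rewrite ru; lia.
elim: t' tt' t'm => // t' IH; rewrite ltnS leq_eqVlt => /predU1P[-> /uS //|tt' t'm].
have [u1 l1] := IH tt' (ltnW t'm); have [u2 l2] := uS _ t'm.
by split; [exact: ltn_trans u1 | exact: lt_trans l1].
Qed.

Lemma chain_of_chain x m tail pred rank : piles x m tail pred rank ->
  [/\ uniq (chain_of m tail pred), all (gtn x) (chain_of m tail pred) &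
   {in chain_of m tail pred &, forall p q, p < q -> lt p q}].
Proof.
move=> H; have [ux uu] := chain_ofP H; split.
- rewrite map_inj_in_uniq ?iota_uniq // => t t'; rewrite !mem_iota => tm t'm eq.
  case: (ltngtP t t') => // tt'; have /= := uu _ _ tt'; rewrite eq; lia.
- by apply/allP => p /mapP[t]; rewrite mem_iota => tm ->; exact: ux.
- move=> p q /mapP[t tm ->] /mapP[t' t'm ->]; rewrite !mem_iota in tm t'm.
  case: (ltngtP t t') => [tt'|tt'|-> ]; last by rewrite ltnn.
    by have /= := uu _ _ tt'; lia.
  by have [] := uu t' t tt' _; [lia|].
Qed.

End Piles.

Section KeyOrder.
Variables (R : realType) (c y : nat -> R).

Definition key_lt (i j : nat) : bool :=
  ((c i < c j) || (c i <= c j) && (y i < y j))%R.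

Lemma key_lt_irr : irreflexive key_lt.
Proof. by move=> i; rewrite /key_lt !ltxx andbF. Qed.

Lemma key_lt_trans : transitive key_lt.
Proof.
move=> j i l; rewrite /key_lt => /orP[ij|/andP[ij ij']] /orP[jl|/andP[jl jl']].
- by rewrite (lt_trans ij jl).
- by rewrite (lt_le_trans ij jl).
- by rewrite (le_lt_trans ij jl).
by rewrite (le_trans ij jl) (lt_trans ij' jl') orbT.
Qed.

Lemma key_ltN i j :
  ~~ key_lt i j = ((c j < c i) || (c j <= c i) && (y j <= y i))%R.
Proof.
rewrite /key_lt; case: (ltgtP (c i) (c j)) => //= _.
by rewrite -leNgt.
Qed.

Lemma key_lt_negtrans i j l : ~~ key_lt i j -> ~~ key_lt j l -> ~~ key_lt i l.
Proof.
rewrite !key_ltN => /orP[ij|/andP[ij ij']] /orP[jl|/andP[jl jl']].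
- by rewrite (lt_trans jl ij).
- by rewrite (le_lt_trans jl ij).
- by rewrite (lt_le_trans jl ij).
by rewrite (le_trans jl ij) (le_trans jl' ij') orbT.
Qed.

End KeyOrder.

(** Natural numbers cannot be divided on this machine, so the midpoints of the binary search come
    from a table of halves. *)
Definition half_table : cmd :=
  for_loop 10 (NAdd (reg 0) (NConst 1))
    (Seq (NStore 4 (NAdd (reg 10) (reg 10)) (reg 10))
         (NStore 4 (NAdd (NAdd (reg 10) (reg 10)) (NConst 1)) (reg 10))).

Definition key_ltb (C Y : nat) (i j : nexpr) : bexpr :=
  bor (rlt (RLoad C i) (RLoad C j))
    (BAnd (RLe (RLoad C i) (RLoad C j)) (rlt (RLoad Y i) (RLoad Y j))).

(* Registers: 16 = number of piles, 20 = lower bound, 21 = upper bound,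
   22 = midpoint. *)
Definition find_pile (C Y : nat) : cmd :=
  Seq (Seq (nset 20 (NConst 0)) (nset 21 (reg 16)))
    (While (NLe (NAdd (reg 20) (NConst 1)) (reg 21))
       (Seq (nset 22 (NLoad 4 (NAdd (reg 20) (reg 21))))
          (If (key_ltb C Y (NLoad 2 (NLoad 5 (reg 22))) (NLoad 2 (reg 10)))
             (nset 20 (NAdd (reg 22) (NConst 1)))
             (nset 21 (reg 22))))).

(** Natural-number bank 5 holds the tails and bank 6 the predecessor links. On pile 0 truncated
    subtraction stores an arbitrary link, which [pl_pred] allows. *)
Definition put_on_pile : cmd :=
  Seq (NStore 6 (reg 10) (NLoad 5 (NSub (reg 20) (NConst 1))))
  (Seq (NStore 5 (reg 20) (reg 10))
       (If (NLe (reg 16) (reg 20)) (nset 16 (NAdd (reg 16) (NConst 1))) Skip)).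

Definition extract_chain : cmd :=
  Seq (nset 23 (NLoad 5 (NSub (reg 16) (NConst 1))))
    (for_loop 10 (reg 16)
       (Seq (NStore 7 (NLoad 2 (reg 23)) (NConst 1))
            (nset 23 (NLoad 6 (reg 23))))).

Definition longest_chain (C Y : nat) : cmd :=
  Seq half_table
  (Seq (nset 16 (NConst 0))
  (Seq (for_loop 10 (reg 0) (Seq (find_pile C Y) put_on_pile))
       extract_chain)).

Section LongestChain.
Variable R : realType.
Implicit Type s : state R.

Lemma half_table_runs s n : nmem s 0 0 = n ->
  runs half_table s (100 * n.+1) (fun s' =>
    forall x, x < n.+1 + n.+1 -> nmem s' 4 x = x./2).
Proof.
move=> sn; pose I k (t : state R) := nmem t 0 0 = n /\
  forall x, x < k + k -> nmem t 4 x = x./2.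
rewrite /half_table; apply: runs_weaken.
- apply: (runs_for (I := I) (N := n.+1)).
  + by [].
  + by move=> k t [tn _] /=; rewrite tn addn1.
  + by [].
  + move=> k t lt_k tk [tn tH]; apply: runs_loop_free => //; split=> //= x.
    rewrite tk => lt_x; case: eqVneq => [->|x1]; first lia.
    by case: eqVneq => [->|x2]; [lia | apply: tH; lia].
  + by split.
- by rewrite /=; lia.
- by move=> t [].
Qed.

Lemma beval_key_ltb s C Y i j : beval s (key_ltb C Y i j) =
  key_lt (rmem s C) (rmem s Y) (neval s i) (neval s j).
Proof. by rewrite /key_ltb /key_lt !(beval_bor, beval_band, beval_rlt). Qed.

Definition pos_lt s C Y : rel nat := fun p q =>
  key_lt (rmem s C) (rmem s Y) (nmem s 2 p) (nmem s 2 q).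

Lemma find_pile_runs C Y s n x m rank :
  nmem s 10 0 = x -> nmem s 16 0 = m -> m <= n ->
  (forall z, z < n.+1 + n.+1 -> nmem s 4 z = z./2) ->
  piles (pos_lt s C Y) x m (nmem s 5) (nmem s 6) rank ->
  runs (find_pile C Y) s (200 * (up_log 2 n).+2) (fun s' =>
    [/\ nmem s' 20 0 <= m,
     forall r, r < nmem s' 20 0 -> pos_lt s C Y (nmem s 5 r) x &
     forall r, nmem s' 20 0 <= r < m -> ~~ pos_lt s C Y (nmem s 5 r) x]).
Proof.
move=> sx sm le_m half H; set lt := pos_lt s C Y in H *.
have lt_tr : transitive lt by move=> p q r; exact: key_lt_trans.
(* The search interval is shorter than [2 ^ r] and a probe halves it; initially its length is at
   most [n], hence below [2 ^ (up_log 2 n).+1]. *)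
pose J r t := [/\ nmem t 20 0 <= nmem t 21 0 <= m,
  nmem t 21 0 - nmem t 20 0 < 2 ^ r,
  forall r, r < nmem t 20 0 -> lt (nmem s 5 r) x,
  forall r, nmem t 21 0 <= r < m -> ~~ lt (nmem s 5 r) x &
  (forall b, b \notin [:: 20; 21; 22] -> nmem t b = nmem s b) /\
  rmem t = rmem s].
apply: runs_weaken.
- apply: (runs_seq (T1 := 7) (Q1 := J (up_log 2 n).+1)).
    apply: runs_loop_free => //; split=> //=.
    + by rewrite sm leqnn.
    + rewrite subn0 sm expnS; have := up_logP n (isT : 1 < 2); lia.
    + by move=> r; rewrite sm; lia.
    + split=> // b; rewrite !inE => nb; apply/funext => i.
      have b1 : (b == 20) = false by lia.
      have b2 : (b == 21) = false by lia.
      by rewrite /= b1 b2.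
  move=> s1 J1; apply: (runs_while (I := J) (T := 100)) J1.
  move=> r t [lohi size_r below above [fr rt]] /=.
  set lo := nmem t 20 0 in lohi size_r below *.
  set hi := nmem t 21 0 in lohi size_r above * => lt_lo.
  case: r size_r => [|r]; first by rewrite expn0; lia.
  rewrite expnS => size_r; exists r => //.
  apply: runs_loop_free => //; rewrite sem_seq sem_if beval_key_ltb /=.
  have [t2 t4 t5 t10] : [/\ nmem t 2 = nmem s 2, nmem t 4 = nmem s 4,
    nmem t 5 = nmem s 5 & nmem t 10 = nmem s 10] by rewrite !fr.
  rewrite -/lo -/hi t2 t4 t5 t10 half; last lia.
  set mid := (lo + hi)./2; have mid_lo : lo <= mid < hi by rewrite /mid; lia.
  rewrite rt sx; have mid_m : mid < m by lia.
  have := pile_search lt_tr H mid_m; rewrite -[key_lt _ _ _ _]/(lt (nmem s 5 mid) x).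
  case: ifP => _ search; split=> //=; rewrite -/lo -/hi; try lia.
  + by rewrite addn1 => r' ?; apply: search.
  + split=> // b nb; rewrite -fr //; move: nb; rewrite !inE => nb.
    apply/funext => i.
    have b1 : (b == 20) = false by lia.
    have b2 : (b == 22) = false by lia.
    by rewrite /= b1 b2.
  + split=> // b nb; rewrite -fr //; move: nb; rewrite !inE => nb.
    apply/funext => i.
    have b1 : (b == 21) = false by lia.
    have b2 : (b == 22) = false by lia.
    by rewrite /= b1 b2.
- by rewrite /=; lia.
- move=> t [nb [r [lohi _ below above _]]].
  have eq : nmem t 20 0 = nmem t 21 0 by move: nb => /=; lia.
  by split=> // [|r']; [lia | rewrite eq; exact: above].
Qed.

Lemma extract_chain_runs s n m : nmem s 16 0 = m -> m <= n ->
  (forall i, nmem s 7 i = 0) ->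
  runs extract_chain s (200 * n.+1) (fun s' => forall i,
    (nmem s' 7 i != 0) =
      (i \in map (nmem s 2) (chain_of m (nmem s 5) (nmem s 6)))).
Proof.
move=> sm le_m s7; pose u k := iter k (nmem s 6) (nmem s 5 m.-1).
pose J k (t : state R) := [/\ nmem t 16 0 = m, nmem t 2 = nmem s 2,
  nmem t 6 = nmem s 6, nmem t 23 0 = u k &
  forall i, (nmem t 7 i != 0) = (i \in [seq nmem s 2 (u r) | r <- iota 0 k])].
rewrite /extract_chain; apply: runs_cost.
- apply: (runs_seq (T1 := 10) (Q1 := J 0)).
    by apply: runs_loop_free => //; split=> //= [|i]; rewrite ?sm ?subn1 // s7.
  move=> t1 J1; apply: runs_weaken.
  + apply: (runs_for (I := J) (N := m) (T := 20)) J1.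
    * by [].
    * by move=> k t' [].
    * by [].
    * move=> k t lt_k tk [tm tP tp tu t7].
      apply: runs_loop_free => //; split=> // [|i]; first by rewrite /= tu tp.
      have -> : iota 0 k.+1 = iota 0 k ++ [:: k] by rewrite -addn1 iotaD.
      rewrite map_cat mem_cat -t7 /= inE tu tP orbC.
      by case: (eqVneq i (nmem s 2 (u k))).
  + exact: leqnn.
  + by move=> t [_ _ _ _ t7] i; rewrite t7 /chain_of -map_comp.
- by rewrite /=; nia.
Qed.

(** The function [rank] certifies optimality: it increases strictly along every chain and takes
    fewer than [m + 1] values. *)
Lemma longest_chain_runs C Y : exists T, forall s n,
  nmem s 0 0 = n -> (forall i, nmem s 7 i = 0) ->
  runs (longest_chain C Y) s (T * nlogn n) (fun s' => exists m sel rank,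
    [/\ size sel = m /\ uniq sel, all (gtn n) sel,
      {in sel &, forall p q, p < q -> pos_lt s C Y p q},
      forall i, (nmem s' 7 i != 0) = (i \in map (nmem s 2) sel) &
      (forall p, p < n -> rank p < m) /\
      (forall p q, p < q -> q < n -> pos_lt s C Y p q -> rank p < rank q)]).
Proof.
exists 2000 => s n sn s7.
set lt := pos_lt s C Y; set P := nmem s 2.
have lt_tr : transitive lt by move=> p q r; exact: key_lt_trans.
have lt_irr : irreflexive lt by move=> p; exact: key_lt_irr.
have lt_neg p q r : ~~ lt p q -> ~~ lt q r -> ~~ lt p r.
  exact: key_lt_negtrans.
pose I x (t : state R) := [/\ nmem t 0 0 = n, nmem t 2 = P, rmem t = rmem s,
  (forall z, z < n.+1 + n.+1 -> nmem t 4 z = z./2) /\ (forall i, nmem t 7 i = 0) &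
  exists rank, piles lt x (nmem t 16 0) (nmem t 5) (nmem t 6) rank].
apply: runs_cost.
- have /runs_frame half := half_table_runs sn.
  apply: (runs_seq half) => s1 [half1 fr1 fr1r].
  apply: (runs_seq (T1 := 3) (Q1 := I 0)).
    apply: runs_loop_free => //; split=> /=.
    - by rewrite fr1.
    - by rewrite (fr1 2).
    - by apply/funext => b; rewrite fr1r.
    - by split=> // i; rewrite (fr1 7).
    - by exists id; split.
  move=> s2 I2; apply: (runs_seq (Q1 := I n)).
    apply: (runs_for (T := 200 * (up_log 2 n).+2 + 100) (I := I)) I2.
    + by [].
    + by move=> k t [].
    + by [].
    + move=> x t lt_x tx [tn tP tr [tH t7] [rank pl]].
      have lt_t : pos_lt t C Y = lt by rewrite /pos_lt tP tr.
      have le_m : nmem t 16 0 <= n by have := pl_le pl; lia.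
      have := @find_pile_runs C Y t n x _ rank tx erefl le_m tH.
      rewrite lt_t => /(_ pl) /runs_frame find.
      apply: (runs_seq find) => t1 [[lo_m below above] fr1' fr1r'].
      have [e5 e6 e10 e16] : [/\ nmem t1 5 = nmem t 5, nmem t1 6 = nmem t 6,
        nmem t1 10 = nmem t 10 & nmem t1 16 = nmem t 16] by rewrite !fr1'.
      have [e0 e2 e4 e7] : [/\ nmem t1 0 = nmem t 0, nmem t1 2 = nmem t 2,
        nmem t1 4 = nmem t 4 & nmem t1 7 = nmem t 7] by rewrite !fr1'.
      have t1r : rmem t1 = rmem s.
        by rewrite -tr; apply/funext => b; rewrite fr1r'.
      apply: runs_loop_free => //; rewrite /put_on_pile !sem_seq sem_if /=.
      have := piles_step lt_irr lt_neg pl lo_m below above.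
      rewrite e10 e16 e5 tx subn1.
      case: ifP => _ pl'; split=> /=; rewrite ?e0 ?e2 ?e4 ?e7 //.
        by exists (upd rank x (nmem t1 20 0)); rewrite e5 e6 addn1.
      by exists (upd rank x (nmem t1 20 0)); rewrite e5 e6 e16.
  move=> t [tn tP tr [tH t7] [rank pl]].
  apply: (runs_weaken (extract_chain_runs erefl (pl_le pl) t7)) => // t' t'7.
  have [c1 c2 c3] := chain_of_chain lt_tr pl.
  exists (nmem t 16 0), (chain_of (nmem t 16 0) (nmem t 5) (nmem t 6)), rank.
  split=> //.
  + by rewrite size_map size_iota.
  + by move=> i; rewrite t'7 tP.
  + by split=> [p /(pl_rank pl)[]//|]; exact: pl_chain pl.
- by rewrite /nlogn /=; nia.
Qed.

End LongestChain.

(** * Selection of a group *)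

(* Bank 8 counts the selected items of each group (bank 9); registers:
   24 = largest count, 25 = a group attaining it. *)
Definition count_groups : cmd :=
  let group := NLoad 9 (reg 10) in
  Seq (Seq (nset 24 (NConst 0)) (nset 25 (NConst 0)))
    (for_loop 10 (reg 0)
       (If (NLe (NConst 1) (NLoad 7 (reg 10)))
          (Seq (NStore 8 group (NAdd (NLoad 8 group) (NConst 1)))
               (If (NLe (reg 24) (NLoad 8 group))
                  (Seq (nset 24 (NLoad 8 group)) (nset 25 group))
                  Skip))
          Skip)).

Definition write_output : cmd :=
  for_loop 10 (reg 0)
    (If (BAnd (NLe (NConst 1) (NLoad 7 (reg 10)))
           (BAnd (NLe (NLoad 9 (reg 10)) (reg 25))
                 (NLe (reg 25) (NLoad 9 (reg 10)))))
       (NStore 1 (reg 10) (NConst 1)) Skip).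

Section Groups.
Variable R : realType.
Implicit Type s : state R.

Lemma select_group_runs s n : nmem s 0 0 = n ->
  (forall i, nmem s 8 i = 0) -> (forall i, nmem s 1 i = 0) ->
  let selected g i := (nmem s 7 i != 0) && (nmem s 9 i == g) in
  runs (Seq count_groups write_output) s (1000 * n.+1) (fun s' =>
    exists g0, (forall i, i < n -> (nmem s' 1 i != 0) = selected g0 i) /\
      forall g, count (selected g) (iota 0 n) <= count (selected g0) (iota 0 n)).
Proof.
move=> sn s8 s1 selected.
have countS (a : pred nat) x : count a (iota 0 x.+1) = count a (iota 0 x) + a x.
  by rewrite -addn1 iotaD count_cat /= addn0.
(* Counts never decrease, so a running maximum is the maximum of the current counts. *)
pose I x (t : state R) := [/\ nmem t 0 0 = n,
  [/\ nmem t 7 = nmem s 7, nmem t 9 = nmem s 9 & forall i, nmem t 1 i = 0],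
  forall g, nmem t 8 g = count (selected g) (iota 0 x),
  nmem t 24 0 = nmem t 8 (nmem t 25 0) & forall g, nmem t 8 g <= nmem t 24 0].
pose J g0 x (t : state R) := [/\ nmem t 0 0 = n, nmem t 25 0 = g0,
  nmem t 7 = nmem s 7 /\ nmem t 9 = nmem s 9 &
  forall i, (nmem t 1 i != 0) = (i < x) && selected g0 i].
apply: runs_cost.
- apply: (runs_seq (Q1 := I n)); rewrite /count_groups /write_output.
    apply: (runs_seq (Q1 := I 0)).
      by apply: runs_loop_free => //; split=> //= g; rewrite s8.
    move=> t0 I0; apply: (runs_for (I := I)) I0.
    + by [].
    + by move=> k t [].
    + by [].
    + move=> x t lt_x tx [tn [t7 t9 t1] t8 tmax tle].
      apply: runs_loop_free => //; rewrite sem_if sem_seq sem_if /= !tx t7 t9.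
      set g1 := nmem s 9 x; rewrite !eqxx /=.
      case: ifP => sel; last first.
        have e g : count (selected g) (iota 0 x.+1) = count (selected g) (iota 0 x).
          rewrite countS /selected; have -> : nmem s 7 x = 0 by lia.
          by rewrite addn0.
        by split=> // g; rewrite e.
      have e g : (if g == g1 then nmem t 8 g1 + 1 else nmem t 8 g) =
          count (selected g) (iota 0 x.+1).
        rewrite countS -t8 /selected -/g1.
        have -> : nmem s 7 x != 0 by lia.
        by rewrite /= [g1 == g]eq_sym; case: eqVneq => [->|_]; rewrite ?addn0.
      case: ifP => le1; split=> //=.
      + by rewrite !eqxx.
      + by move=> g; rewrite ?eqxx /=; have := tle g; case: ifP; move: le1; rewrite ?tmax ?eqxx; lia.
      + by rewrite tmax; case: eqVneq => // eq; move: le1; rewrite tmax eq; lia.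
      + by move=> g; have := tle g; case: ifP => _; lia.
  move=> t [tn [t7 t9 t1] t8 tmax tle].
  apply: runs_weaken.
  + apply: (runs_for (I := J (nmem t 25 0)) (N := n)).
    * by [].
    * by move=> k t' [].
    * by [].
    * move=> x t' lt_x tx [t'n t'g [t'7 t'9] t'1].
      apply: runs_loop_free => //; rewrite sem_if /= tx t'g t'7 t'9.
      have -> : [&& 0 < nmem s 7 x, nmem s 9 x <= nmem t 25 0 &
          nmem t 25 0 <= nmem s 9 x] = selected (nmem t 25 0) x.
        by rewrite /selected -eqn_leq lt0n.
      case: ifP => sel; split=> //= i; rewrite ?t'1 ltnS [i <= x]leq_eqVlt.
        by case: (eqVneq i x) => [->|_]; rewrite ?sel ?t'1.
      by case: (eqVneq i x) => [->|_]; rewrite ?sel ?andbF.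
    * by split=> // i; rewrite t1.
  + exact: leqnn.
  + move=> t' [_ _ _ t'1]; exists (nmem t 25 0); split=> [i lt_i|g].
      by rewrite t'1 lt_i.
    by rewrite -!t8 -tmax.
- by rewrite /=; lia.
Qed.

End Groups.

(** * Preprocessing *)

Definition fill (b : nat) (c : bexpr) (e1 e2 : rexpr) : cmd :=
  for_loop 10 (reg 0) (If c (RStore b (reg 10) e1) (RStore b (reg 10) e2)).

(** The address [4i + j] is built by additions, naturals having no multiplication. *)
Definition coord (j : nat) : rexpr :=
  RLoad 0 (NAdd (NAdd (NAdd (reg 10) (reg 10)) (NAdd (reg 10) (reg 10)))
                (NConst j)).

Definition right_test : bexpr := RLe (coord 0) (coord 2).
Definition up_test : bexpr := RLe (coord 1) (coord 3).

(* Real banks filled by the preprocessing: 7 = constant 1, 8 and 9 = lengths of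
   the arms, 10 and 11 = corner after reflection to the shape with right and
   upward arms, 12 = code of the original shape (13 is scratch space). *)
Definition preprocess : cmd :=
  Seq (for_loop 10 (reg 0) (NStore 2 (reg 10) (reg 10)))
  (Seq (fill 7 up_test (RConst 1) (RConst 1))
  (Seq (fill 8 right_test (RSub (coord 2) (coord 0)) (RSub (coord 0) (coord 2)))
  (Seq (fill 9 up_test (RSub (coord 3) (coord 1)) (RSub (coord 1) (coord 3)))
  (Seq (fill 10 right_test (coord 0) (RSub (RConst 0) (coord 0)))
  (Seq (fill 11 up_test (coord 1) (RSub (RConst 0) (coord 1)))
  (Seq (fill 13 right_test (RConst 0) (RConst 1))
       (fill 12 up_test (RLoad 13 (reg 10))
          (RAdd (RLoad 13 (reg 10)) (RConst 2))))))))).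

Section Preprocess.
Variable R : realType.
Implicit Types (s : state R) (l : ell R).
Local Open Scope ring_scope.

Definition is_right l : bool := corner_x l <= hend_x l.
Definition is_up l : bool := corner_y l <= vend_y l.
Definition reflect_if (b : bool) (v : R) : R := if b then v else - v.
Definition norm_x l : R := reflect_if (is_right l) (corner_x l).
Definition norm_y l : R := reflect_if (is_up l) (corner_y l).
Definition shape_code l : nat := (~~ is_right l + (~~ is_up l).*2)%N.

Lemma ell0_subproof : ((1 : R) != 0) && ((1 : R) != 0).
Proof. by rewrite oner_eq0. Qed.

Definition ell0 : ell R := @Ell R ((0, 0), (1, 1)) ell0_subproof.

Definition preprocessed (ls : seq (ell R)) s : Prop :=
  forall i, (i < size ls)%N -> let l := nth ell0 ls i in
  [/\ nmem s 2 i = i,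
    [/\ rmem s 7 i = 1, rmem s 8 i = hlen l & rmem s 9 i = vlen l],
    rmem s 10 i = norm_x l, rmem s 11 i = norm_y l &
    rmem s 12 i = (shape_code l)%:R].

Lemma input_coord (ls : seq (ell R)) i j :
  (i < size ls)%N -> (j < 4)%N -> let l := nth ell0 ls i in
  rmem (input ls) 0 (i + i + (i + i) + j) =
    [:: corner_x l; corner_y l; hend_x l; vend_y l]`_j.
Proof.
move=> + j4; rewrite /=; elim: ls i => // l ls IH [|i] lt_i.
  by move: j4; clear; case: j => [|[|[|[|]]]].
have -> : (i.+1 + i.+1 + (i.+1 + i.+1) + j = (i + i + (i + i) + j).+4)%N by lia.
by rewrite -IH.
Qed.

Lemma fill_runs b c e1 e2 s n (v : nat -> R) : nmem s 0 0 = n ->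
  (forall (t : state R) i, (i < n)%N -> nmem t 10 0 = i ->
     (forall b', b' != b -> rmem t b' = rmem s b') ->
     (if beval t c then reval t e1 else reval t e2) = v i) ->
  runs (fill b c e1 e2) s ((bcost c + (rcost e1 + rcost e2) + 50) * n.+1)
    (fun s' => [/\ nmem s' 0 0 = n, nmem s' 2 = nmem s 2,
      forall b', b' != b -> rmem s' b' = rmem s b' &
      forall i, (i < n)%N -> rmem s' b i = v i]).
Proof.
move=> sn ev; pose I k (t : state R) := [/\ nmem t 0 0 = n,
  nmem t 2 = nmem s 2, (forall b', b' != b -> rmem t b' = rmem s b') &
  forall i, (i < k)%N -> rmem t b i = v i].
apply: runs_weaken.
- apply: (runs_for (I := I) (N := n)).
  + by [].
  + by move=> k t [].
  + by [].
  + move=> k t lt_k tk [tn t2 told tI].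
    apply: runs_loop_free => //; rewrite sem_if_rstore (ev t k) //=.
    split=> //= [b' nb|i].
      by rewrite -told //; apply/funext => i /=; rewrite (negbTE nb).
    rewrite ltnS leq_eqVlt tk eqxx /=.
    by case: (eqVneq i k) => [-> //|_ /=]; exact: tI.
  + by split.
- by rewrite /=; nia.
- by move=> t [].
Qed.

Lemma preprocess_runs (ls : seq (ell R)) :
  runs preprocess (input ls) (1000 * (size ls).+1) (preprocessed ls).
Proof.
set s := input ls; set n := size ls.
have sn : nmem s 0 0 = n by [].
pose l := nth ell0 ls.
have coordE (t : state R) i j : (i < n)%N -> nmem t 10 0 = i ->
    rmem t 0 = rmem s 0 -> (j < 4)%N -> reval t (coord j) =
    [:: corner_x (l i); corner_y (l i); hend_x (l i); vend_y (l i)]`_j.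
  by move=> lt_i ti t0 lt_j; rewrite -input_coord //= ti t0.
have rightE (t : state R) i : (i < n)%N -> nmem t 10 0 = i ->
    rmem t 0 = rmem s 0 -> beval t right_test = is_right (l i).
  by move=> lt_i ti t0; rewrite [LHS]/(_ <= _) !(coordE t i).
have upE (t : state R) i : (i < n)%N -> nmem t 10 0 = i ->
    rmem t 0 = rmem s 0 -> beval t up_test = is_up (l i).
  by move=> lt_i ti t0; rewrite [LHS]/(_ <= _) !(coordE t i).
have subE (t : state R) e e' : reval t (RSub e e') = reval t e - reval t e'.
  by [].
have hlenE i : (if is_right (l i) then hend_x (l i) - corner_x (l i)
    else corner_x (l i) - hend_x (l i)) = hlen (l i).
  rewrite /hlen /is_right; case: leP => h; first by rewrite ger0_norm // subr_ge0.
  by rewrite ltr0_norm ?opprB // subr_lt0.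
have vlenE i : (if is_up (l i) then vend_y (l i) - corner_y (l i)
    else corner_y (l i) - vend_y (l i)) = vlen (l i).
  rewrite /vlen /is_up; case: leP => h; first by rewrite ger0_norm // subr_ge0.
  by rewrite ltr0_norm ?opprB // subr_lt0.
rewrite /preprocess; apply: runs_cost.
- pose I k (t : state R) := nmem t 0 0 = n /\ forall i, (i < k)%N -> nmem t 2 i = i.
  have iota_run : runs (for_loop 10 (reg 0) (NStore 2 (reg 10) (reg 10))) s
      ((10 + 2 + 20) * n.+1) (I n).
    apply: (runs_for (I := I) (N := n)) => //; first by move=> k t [].
    move=> k t lt_k tk [tn tI]; apply: runs_loop_free => //; split=> //= i.
    rewrite ltnS leq_eqVlt tk.
    by case: (eqVneq i k) => [-> //|_ /=]; exact: tI.
  have /runs_frame {}iota_run := iota_run.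
  apply: (runs_seq iota_run) => s1 [[n1 i1] _ r1].
  have {}r1 : rmem s1 = rmem s by apply/funext => b; rewrite r1.
  have z1 : rmem s1 0 = rmem s 0 by rewrite r1.
  apply: runs_seq.
    apply: (@fill_runs 7 _ _ _ s1 n (fun=> 1)) => // t i _ _ _.
    by rewrite if_same.
  move=> s2 [n2 i2 r2 v2]; have {}z2 : rmem s2 0 = rmem s 0 by rewrite r2.
  apply: runs_seq.
    apply: (@fill_runs 8 _ _ _ s2 n (fun i => hlen (l i))) => // t i lt_i ti told.
    have t0 : rmem t 0 = rmem s 0 by rewrite told.
    by rewrite !subE !(coordE t i) // (rightE t i) // -hlenE.
  move=> s3 [n3 i3 r3 v3]; have {}z3 : rmem s3 0 = rmem s 0 by rewrite r3.
  apply: runs_seq.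
    apply: (@fill_runs 9 _ _ _ s3 n (fun i => vlen (l i))) => // t i lt_i ti told.
    have t0 : rmem t 0 = rmem s 0 by rewrite told.
    by rewrite !subE !(coordE t i) // (upE t i) // -vlenE.
  move=> s4 [n4 i4 r4 v4]; have {}z4 : rmem s4 0 = rmem s 0 by rewrite r4.
  apply: runs_seq.
    apply: (@fill_runs 10 _ _ _ s4 n (fun i => norm_x (l i))) => // t i lt_i ti told.
    have t0 : rmem t 0 = rmem s 0 by rewrite told.
    by rewrite !subE !(coordE t i) // (rightE t i) //= sub0r.
  move=> s5 [n5 i5 r5 v5]; have {}z5 : rmem s5 0 = rmem s 0 by rewrite r5.
  apply: runs_seq.
    apply: (@fill_runs 11 _ _ _ s5 n (fun i => norm_y (l i))) => // t i lt_i ti told.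
    have t0 : rmem t 0 = rmem s 0 by rewrite told.
    by rewrite !subE !(coordE t i) // (upE t i) //= sub0r.
  move=> s6 [n6 i6 r6 v6]; have {}z6 : rmem s6 0 = rmem s 0 by rewrite r6.
  apply: runs_seq.
    apply: (@fill_runs 13 _ _ _ s6 n (fun i => (~~ is_right (l i) : nat)%:R)) => // t i lt_i ti told.
    have t0 : rmem t 0 = rmem s 0 by rewrite told.
    by rewrite (rightE t i) //; case: is_right.
  move=> s7 [n7 i7 r7 v7]; have {}z7 : rmem s7 0 = rmem s 0 by rewrite r7.
  apply: runs_weaken.
  + apply: (@fill_runs 12 _ _ _ s7 n (fun i => (shape_code (l i))%:R)) => // t i lt_i ti told.
    have t0 : rmem t 0 = rmem s 0 by rewrite told.
    rewrite (upE t i) //= ti told // v7 // /shape_code natrD.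
    by case: is_up; rewrite /= ?addr0.
  + exact: leqnn.
  + move=> s8 [n8 i8 r8 v8] i lt_i.
    rewrite i8 i7 i6 i5 i4 i3 i2 i1 // v8 //; split=> //.
    * split; first by rewrite r8 // r7 // r6 // r5 // r4 // r3 // v2.
        by rewrite r8 // r7 // r6 // r5 // r4 // v3.
      by rewrite r8 // r7 // r6 // r5 // v4.
    * by rewrite r8 // r7 // r6 // v5.
    * by rewrite r8 // r7 // v6.
- by rewrite /= -/n; lia.
Qed.

End Preprocess.

(** * Geometry of l's and of buckets *)

Section Geometry.
Variable R : realType.
Implicit Types l : ell R.
Local Open Scope ring_scope.

Lemma hlen_gt0 l : 0 < hlen l.
Proof.
by rewrite normr_gt0 subr_eq0; have /andP[] := valP l.
Qed.

Lemma vlen_gt0 l : 0 < vlen l.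
Proof.
by rewrite normr_gt0 subr_eq0; have /andP[] := valP l.
Qed.

(** Negating the coordinate of an arm that points the wrong way reverses its inequalities, so one
    formula serves all four shapes. *)
Lemma interval_reflect (u v t : R) : let b := u <= v in
  (Num.min u v <= t <= Num.max u v) =
  (reflect_if b u <= reflect_if b t <= reflect_if b u + `|v - u|).
Proof.
rewrite /reflect_if; case: (leP u v) => uv /=.
  by rewrite ger0_norm ?subr_ge0 // [u + _]addrC subrK.
rewrite ltr0_norm ?subr_lt0 // lerN2 andbC; congr (_ && _).
by rewrite opprB addrA addNr sub0r lerN2.
Qed.

Lemma reflect_if_inj b : injective (@reflect_if R b).
Proof. by case: b => // u v /oppr_inj. Qed.

Lemma reflect_ifK b (u : R) : reflect_if b (reflect_if b u) = u.
Proof. by case: b; rewrite //= opprK. Qed.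

Lemma pointsP l (p : R * R) :
  let X := reflect_if (is_right l) p.1 in let Y := reflect_if (is_up l) p.2 in
  points l p <->
  (norm_x l <= X <= norm_x l + hlen l /\ Y = norm_y l) \/
  (X = norm_x l /\ norm_y l <= Y <= norm_y l + vlen l).
Proof.
rewrite /points /harm /varm /norm_x /norm_y /hlen /vlen /is_right /is_up /=.
split=> [[[h1 h2]|[h1 h2]]|[[h1 h2]|[h1 h2]]].
- by left; rewrite -interval_reflect h1 h2.
- by right; rewrite -interval_reflect h1 h2.
- by left; split; [rewrite interval_reflect | exact: reflect_if_inj h2].
- by right; split; [exact: reflect_if_inj h1 | rewrite interval_reflect].
Qed.

Lemma same_shape l l' : shape_code l = shape_code l' ->
  is_right l = is_right l' /\ is_up l = is_up l'.
Proof.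
by rewrite /shape_code; do 2!case: (is_right _); do 2!case: (is_up _).
Qed.

Lemma shape_lt4 l : (shape_code l < 4)%N.
Proof. by rewrite /shape_code; case: is_right; case: is_up. Qed.

Lemma crossing_adjacent l l' : shape_code l = shape_code l' -> l <> l' ->
  norm_x l <= norm_x l' <= norm_x l + hlen l ->
  norm_y l' <= norm_y l <= norm_y l' + vlen l' ->
  ell_adjacent l l'.
Proof.
move=> /same_shape[sx sy] ne hx hy; split=> //.
(* The point where the horizontal arm of [l] crosses the vertical arm of [l']. *)
exists (reflect_if (is_right l) (norm_x l'), reflect_if (is_up l) (norm_y l)).
split; apply/pointsP => /=.
  by left; rewrite !reflect_ifK.
by right; rewrite -sx -sy !reflect_ifK.
Qed.

(** After reflection [l'] lies in the closed quadrant above and to the right of its corner, and in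
    all three cases this quadrant misses [l]. *)
Lemma separated_nonadjacent l l' : shape_code l = shape_code l' ->
  [\/ norm_x l + hlen l < norm_x l', norm_y l + vlen l < norm_y l' |
      norm_x l < norm_x l' /\ norm_y l < norm_y l'] ->
  ~ ell_adjacent l l'.
Proof.
move=> /same_shape[sx sy] sep [_ [p [/pointsP + /pointsP]]].
rewrite -sx -sy.
have := hlen_gt0 l; have := hlen_gt0 l'; have := vlen_gt0 l; have := vlen_gt0 l'.
move=> v' v h' h [[/andP[a1 a2] a3]|[a1 /andP[a2 a3]]]
  [[/andP[b1 b2] b3]|[b1 /andP[b2 b3]]]; case: sep => [c|c|[c1 c2]]; lra.
Qed.

Lemma ell_adjacent_sym l l' : ell_adjacent l l' -> ell_adjacent l' l.
Proof. by move=> [ne [p [p1 p2]]]; split; [exact/nesym | exists p]. Qed.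

End Geometry.

Section BucketMath.
Variable R : realType.
Local Open Scope ring_scope.
Implicit Types c k w : nat -> R.

Lemma bucketing_eq c k w c' k' w' D nb e id :
  {in D, c =1 c'} -> {in D, k =1 k'} -> {in D, w =1 w'} ->
  bucketing c k w D nb e id -> bucketing c' k' w' D nb e id.
Proof.
move=> cc kk ww [h1 h2 h3 h4 h5 h6].
have eD i : i \in D -> e (id i) \in D by move=> /h1 /h4.
split=> //.
- by move=> i iD; rewrite -!cc ?eD ?h2.
- by move=> i iD; rewrite -!kk -?ww ?eD ?h3.
- by move=> b b_b; have := h6 b b_b; rewrite !cc ?kk ?ww // h4 //; lia.
Qed.

(** Iteration of [bk_next]: the class never decreases, and as long as it stays the same, so does the
    width. *)
Lemma bucketing_far c k w D nb e id b t : bucketing c k w D nb e id ->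
  {in D &, forall i j, c i = c j -> w i = w j} -> (0 < b)%N -> (b + t <= nb)%N ->
  c (e b) < c (e (b + t)%N) \/
  c (e b) = c (e (b + t)%N) /\ k (e b) + t%:R * w (e b) <= k (e (b + t)%N).
Proof.
move=> [_ _ _ h4 _ h6] cw b0; elim: t => [|t IH] le_nb.
  by right; rewrite addn0 mul0r addr0.
have bt : (0 < b + t < nb)%N by lia.
have := h6 _ bt; rewrite addnS.
case: IH => [|lt_c|[eq_c le_k]]; first lia.
  by case=> [lt_c'|[<- _]]; left => //; exact: lt_trans lt_c'.
case=> [lt_c'|[eq_c' le_k']]; first by left; rewrite eq_c.
right; split; first by rewrite eq_c.
have eq_w : w (e b) = w (e (b + t)%N) by apply: cw; rewrite ?h4 //; lia.
apply: le_trans le_k'; rewrite -eq_w -natr1 mulrDl mul1r addrA lerD2r.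
exact: le_k.
Qed.

(** With natural keys and width 1 a bucket holds exactly the items with one given pair. Bucketing
    thus numbers pairs of codes without arithmetic on them. *)
Lemma bucketing_refine (c k : nat -> nat) D nb e id i j :
  bucketing (fun i => (c i)%:R) (fun i => (k i)%:R) (fun=> 1 : R) D nb e id ->
  i \in D -> j \in D -> id i = id j <-> c i = c j /\ k i = k j.
Proof.
move=> B; have natE x : x \in D -> c (e (id x)) = c x /\ k (e (id x)) = k x.
  move=> xD; have := bk_class B xD; have := bk_range B xD.
  rewrite natr1 ler_nat ltr_nat => kx /eqP; rewrite eqr_nat => /eqP.
  by split=> //; lia.
move=> iD jD; have [ci ki] := natE i iD; have [cj kj] := natE j jD.
split=> [eq|[eqc eqk]]; first by rewrite -ci -cj -ki -kj eq.
have far i' j' : i' \in D -> j' \in D -> c i' = c j' -> k i' = k j' ->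
    (id i' <= id j')%N -> ~~ (id i' < id j')%N.
  move=> iD' jD' eqc' eqk' le_id; have /andP[i0 _] := bk_id B iD'.
  have /andP[_ jnb] := bk_id B jD'.
  have [ci' ki'] := natE i' iD'; have [cj' kj'] := natE j' jD'.
  apply/negP => lt_id.
  have := @bucketing_far _ _ _ _ _ _ _ (id i') (id j' - id i')%N B.
  rewrite subnKC // => /(_ _ i0 jnb)[//||[_]].
    by rewrite ci' cj' eqc' ltxx.
  by rewrite ki' kj' eqk' mulr1 -natrD ler_nat; lia.
have := far i j iD jD eqc eqk; have := far j i jD iD (esym eqc) (esym eqk); lia.
Qed.

(** The width of a bucket is the key of its first item, so the next bucket starts at twice that key
    or later. *)
Lemma bucketing_double k D nb e id : bucketing (fun=> 0) k k D nb e id ->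
  {in D, forall i, 0 < k i} ->
  forall t, (t < nb)%N -> k (e 1) * 2 ^+ t <= k (e t.+1).
Proof.
move=> [_ _ _ h4 _ h6] k0; elim=> [|t IH] lt_nb; first by rewrite expr0 mulr1.
have /h6[|[_ le_k]] : (0 < t.+1 < nb)%N by lia.
  by rewrite ltxx.
apply: le_trans le_k; rewrite exprS mulrCA mulr_natl mulr2n.
by have := IH (ltnW lt_nb); lra.
Qed.

End BucketMath.

Section LengthClasses.
Variable R : realType.
Local Open Scope ring_scope.

Lemma max_over_ge (f : ell R -> R) (L : {fset ell R}) l : l \in L ->
  f l <= max_over f L.
Proof. by move=> lL; rewrite /max_over; apply: le_bigmax_seq. Qed.

Lemma min_over_le (f : ell R -> R) (L : {fset ell R}) l : l \in L ->
  min_over f L <= f l.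
Proof. by move=> lL; rewrite /min_over; exact: ge_bigmin_seq. Qed.

Lemma min_over_gt0 (f : ell R -> R) (L : {fset ell R}) l : l \in L ->
  (forall l, 0 < f l) -> 0 < min_over f L.
Proof.
move=> lL f0; rewrite /min_over; elim/big_ind: _ => //.
- by apply: lt_le_trans (max_over_ge f lL).
- by move=> x y x0 y0; rewrite lt_min x0.
Qed.

Lemma log2_double (x : R) : 0 < x -> log2 (2 * x) = 1 + log2 x.
Proof.
move=> x0; rewrite /log2 lnM ?posrE // mulrDl divff //.
by rewrite gt_eqF // ln_gt0 // ltr1n.
Qed.

Lemma pow2_log2 n (x : R) : 2 ^+ n <= x -> n%:R <= log2 x.
Proof.
move=> nx; have x0 : 0 < x by apply: lt_le_trans nx; rewrite exprn_gt0.
rewrite /log2 ler_pdivlMr ?ln_gt0 ?ltr1n // mulr_natl -lnXn //.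
by rewrite ler_ln ?posrE // exprn_gt0.
Qed.

End LengthClasses.

(** * Correctness of the selection *)

Section Strips.
Variable R : realType.
Local Open Scope ring_scope.
Variables (D : seq nat) (h x : nat -> R) (na np : nat) (ea ca ep p : nat -> nat).
Hypotheses (Ba : bucketing (fun=> 0) h h D na ea ca)
  (Bp : bucketing (fun i => (ca i)%:R) x (fun i => h (ea (ca i))) D np ep p).

Let width i (iD : i \in D) : h (ea (ca i)) <= h i < 2 * h (ea (ca i)).
Proof. by have := bk_range Ba iD; rewrite mulr_natl mulr2n. Qed.

Let strip i (iD : i \in D) :
  x (ep (p i)) <= x i < x (ep (p i)) + h (ea (ca i)).
Proof.
have := bk_range Bp iD; have /eqP := bk_class Bp iD.
by rewrite eqr_nat => /eqP ->.
Qed.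

(** A strip is only as wide as the shortest length of its class. *)
Lemma strip_close i j : i \in D -> j \in D -> ca i = ca j -> p i = p j ->
  x j < x i + h i.
Proof.
move=> iD jD ca_ij p_ij.
have := width iD; have := strip iD; have := strip jD; rewrite -p_ij -ca_ij; lra.
Qed.

(** If [a] is the shortest length of the class, distinct strips with equal residue start at least
    [3a] apart, whereas [x i + h i] is less than [a + 2a] beyond the start of the strip of [i]. *)
Lemma strip_far i j : i \in D -> j \in D -> ca i = ca j ->
  (p i %% 3 = p j %% 3)%N -> (p i < p j)%N -> x i + h i < x j.
Proof.
move=> iD jD ca_ij p3 lt_p.
have /andP[i0 _] := bk_id Bp iD; have /andP[_ jnp] := bk_id Bp jD.
have := @bucketing_far _ _ _ _ _ _ _ _ (p i) (p j - p i) Bp.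
rewrite subnKC ?(ltnW lt_p) // => /(_ _ i0 jnp) far.
have {far} : x (ep (p i)) + (p j - p i)%:R * h (ea (ca (ep (p i)))) <= x (ep (p j)).
  case: far => [i' j' _ _ /eqP|lt_c|[_ //]].
    by rewrite eqr_nat => /eqP ->.
  by move: lt_c; rewrite (bk_class Bp iD) (bk_class Bp jD) ca_ij ltxx.
have /eqP := bk_class Bp iD; rewrite eqr_nat => /eqP -> far.
have := width iD; have := strip iD; have := strip jD; rewrite -ca_ij.
move=> /andP[sj _] /andP[_ si] /andP[w1 w2].
have w0 : 0 < h (ea (ca i)) by lra.
have : 3 * h (ea (ca i)) <= (p j - p i)%:R * h (ea (ca i)).
  by rewrite ler_pM2r // ler_nat; lia.
lra.
Qed.

End Strips.

Lemma size_le_fibers (T : eqType) (S : seq nat) (f : nat -> T) (codes : seq T)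
  (best : nat) :
  {in S, forall i, f i \in codes} ->
  {in S, forall i, count (fun j => f j == f i) S <= best} ->
  size S <= size codes * best.
Proof.
move=> f_codes le_best.
have : size S <= \sum_(c <- codes) count (fun j => f j == c) S.
  elim: S f_codes {le_best} => //= i S IH f_codes.
  rewrite big_split /= -add1n leq_add //; last first.
    by apply: IH => j jS; apply: f_codes; rewrite inE jS orbT.
  have : f i \in codes by apply: f_codes; rewrite inE eqxx.
  elim: codes {f_codes IH} => // c codes IH; rewrite big_cons inE.
  by case: eqVneq => //= _ /IH.
move=> /leq_trans; apply.
have le_c c : count (fun j => f j == c) S <= best.
  have [/hasP[j jS /eqP <-]|] := boolP (has (fun j => f j == c) S); first exact: le_best.
  by rewrite has_count -leqNgt leqn0 => /eqP ->.
elim: codes {f_codes} => [|c codes IH]; first by rewrite big_nil.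
by rewrite big_cons /= mulSn leq_add.
Qed.

Lemma mask_map_iota (T : Type) (x0 : T) (a : pred nat) (s : seq T) :
  mask [seq a i | i <- iota 0 (size s)] s =
  [seq nth x0 s i | i <- iota 0 (size s) & a i].
Proof.
rewrite filter_mask map_mask; congr mask.
by rewrite -[RHS]/(mkseq (nth x0 s) (size s)) mkseq_nth.
Qed.

Section Selection.
Variable R : realType.
Local Open Scope ring_scope.
Variables (L : {fset ell R}) (ls : seq (ell R)).
Hypotheses (ls_uniq : uniq ls) (lsL : ls =i L).
Notation n := (size ls).
Notation D := (iota 0 n).
Notation l := (nth (ell0 R) ls).

Variables (na nb np nq : nat) (ea eb ep eq ca cb p q cell group P : nat -> nat).
Hypotheses
  (Ba : bucketing (fun=> 0) (fun i => hlen (l i)) (fun i => hlen (l i)) D na ea ca)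
  (Bb : bucketing (fun=> 0) (fun i => vlen (l i)) (fun i => vlen (l i)) D nb eb cb)
  (Bp : bucketing (fun i => (ca i)%:R) (fun i => norm_x (l i))
          (fun i => hlen (l (ea (ca i)))) D np ep p)
  (Bq : bucketing (fun i => (cb i)%:R) (fun i => norm_y (l i))
          (fun i => vlen (l (eb (cb i)))) D nq eq q).
Hypothesis cellP : {in D &, forall i j, cell i = cell j <->
  (shape_code (l i) = shape_code (l j) /\ p i = p j) /\ q i = q j}.
Hypothesis groupP : {in D &, forall i j, group i = group j <->
  (((shape_code (l i) = shape_code (l j) /\ ca i = ca j) /\ cb i = cb j) /\
    (p i %% 3 = p j %% 3)%N) /\ (q i %% 3 = q j %% 3)%N}.
Hypotheses (permP : perm_eq (mkseq P n) D)
  (sortedP : forall u v, (u <= v)%N -> (v < n)%N ->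
     lexle (fun i => (cell i)%:R) (fun i => norm_x (l i))
       (fun i => norm_y (l i)) (P u) (P v)).

Notation key := (key_lt (fun i => (cell i)%:R) (fun i => norm_y (l i))).

Let DE i : (i \in D) = (i < n)%N. Proof. by rewrite mem_iota. Qed.

Let P_lt u : (u < n)%N -> P u \in D.
Proof. by move=> ?; rewrite -(perm_mem permP) map_f ?mem_iota. Qed.

Let l_inj i j : i \in D -> j \in D -> l i = l j -> i = j.
Proof. by rewrite !DE => iD jD /eqP; rewrite nth_uniq // => /eqP. Qed.

Let P_inj u v : (u < n)%N -> (v < n)%N -> P u = P v -> u = v.
Proof.
move=> un vn; have : uniq (mkseq P n) by rewrite (perm_uniq permP) iota_uniq.
by move=> /mkseq_uniqP; apply.
Qed.

Let p_class i j : i \in D -> j \in D -> p i = p j -> ca i = ca j.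
Proof.
move=> iD jD pij; have := bk_class Bp iD; rewrite pij (bk_class Bp jD).
by move=> /eqP; rewrite eqr_nat => /eqP.
Qed.

Let q_class i j : i \in D -> j \in D -> q i = q j -> cb i = cb j.
Proof.
move=> iD jD pij; have := bk_class Bq iD; rewrite pij (bk_class Bq jD).
by move=> /eqP; rewrite eqr_nat => /eqP.
Qed.

(** If one corner were weakly to the left of and above the other, its horizontal arm would cross the
    vertical arm of the other, since by [strip_close] both arms are long enough. *)
Lemma cell_chain i j : i \in D -> j \in D -> i <> j -> cell i = cell j ->
  ~ ell_adjacent (l i) (l j) ->
  norm_x (l i) < norm_x (l j) /\ norm_y (l i) < norm_y (l j) \/
  norm_x (l j) < norm_x (l i) /\ norm_y (l j) < norm_y (l i).
Proof.
move=> iD jD ij /(cellP iD jD)[[sh pij] qij] nadj.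
have lij : l i <> l j by move/(l_inj iD jD).
have x1 := strip_close Ba Bp iD jD (p_class iD jD pij) pij.
have x2 := strip_close Ba Bp jD iD (esym (p_class iD jD pij)) (esym pij).
have y1 := strip_close Bb Bq iD jD (q_class iD jD qij) qij.
have y2 := strip_close Bb Bq jD iD (esym (q_class iD jD qij)) (esym qij).
have c1 : ~ (norm_x (l i) <= norm_x (l j) /\ norm_y (l j) <= norm_y (l i)).
  by move=> [h1 h2]; apply: nadj; apply: crossing_adjacent => //; lra.
have c2 : ~ (norm_x (l j) <= norm_x (l i) /\ norm_y (l i) <= norm_y (l j)).
  move=> [h1 h2]; apply: nadj; apply: ell_adjacent_sym.
  by apply: crossing_adjacent => //; [exact: nesym | lra | lra].
case: (ltP (norm_x (l i)) (norm_x (l j))) => hx;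
  case: (ltP (norm_y (l i)) (norm_y (l j))) => hy; [by left| | |].
- by case: c1; split=> //; exact: ltW.
- by case: c2; split=> //; exact: ltW.
- case: (ltgtP (norm_x (l i)) (norm_x (l j))) hx => // hx _; last first.
    by case: c1; rewrite hx.
  case: (ltgtP (norm_y (l i)) (norm_y (l j))) hy => // hy _; first by right.
  by case: c2; rewrite hy; split=> //; exact: ltW.
Qed.

(** Different cells of a group differ in a strip number, and the residues agree, so [strip_far]
    separates them in that direction. *)
Lemma group_far i j : i \in D -> j \in D -> group i = group j ->
  cell i <> cell j -> ~ ell_adjacent (l i) (l j).
Proof.
move=> iD jD /(groupP iD jD)[[[[sh caij] cbij] p3] q3] cij adj.
have adj' := ell_adjacent_sym adj.
have [pij|pij|pij] := ltngtP (p i) (p j).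
- have := strip_far Ba Bp iD jD caij p3 pij.
  by move=> sep; apply: (separated_nonadjacent sh _ adj); constructor 1.
- have := strip_far Ba Bp jD iD (esym caij) (esym p3) pij.
  by move=> sep; apply: (separated_nonadjacent (esym sh) _ adj'); constructor 1.
have [qij|qij|qij] := ltngtP (q i) (q j).
- have := strip_far Bb Bq iD jD cbij q3 qij.
  by move=> sep; apply: (separated_nonadjacent sh _ adj); constructor 2.
- have := strip_far Bb Bq jD iD (esym cbij) (esym q3) qij.
  by move=> sep; apply: (separated_nonadjacent (esym sh) _ adj'); constructor 2.
by apply: cij; apply/(cellP iD jD).
Qed.

(** Inside a cell the sorting by abscissa rules out the second alternative of [cell_chain]. *)
Lemma nonadjacent_key u v : (u < v)%N -> (v < n)%N ->
  ~ ell_adjacent (l (P u)) (l (P v)) -> key (P u) (P v).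
Proof.
move=> uv vn nadj; have un : (u < n)%N by lia.
have := sortedP (ltnW uv) vn; rewrite /lexle /key_lt => /orP[-> //|/andP[le_c xy]].
have [//|] := ltP (cell (P u))%:R (cell (P v))%:R.
rewrite ler_nat => ge_c; rewrite ler_nat in le_c *.
have eq_c : cell (P u) = cell (P v) by apply/eqP; rewrite eqn_leq le_c.
rewrite le_c orbC /=; apply/orP; left.
have Puv : P u <> P v by move/(P_inj un vn); lia.
case: (cell_chain (P_lt un) (P_lt vn) Puv eq_c nadj) => -[hx hy] //.
by case/orP: xy => [|/andP[]] *; lra.
Qed.

(** Equal abscissae are sorted by decreasing ordinate, so inside a cell an increase of the ordinate
    forces a strict increase of the abscissa as well. *)
Lemma key_nonadjacent u v : (u < v)%N -> (v < n)%N ->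
  group (P u) = group (P v) -> key (P u) (P v) ->
  ~ ell_adjacent (l (P u)) (l (P v)).
Proof.
move=> uv vn guv kuv; have un : (u < n)%N by lia.
have [eq_c|ne_c] := eqVneq (cell (P u)) (cell (P v)); last first.
  by apply: group_far; rewrite ?P_lt //; apply/eqP.
have [[sh _] _] := (cellP (P_lt un) (P_lt vn)).1 eq_c.
apply: separated_nonadjacent sh _; constructor 3.
have := sortedP (ltnW uv) vn; move: kuv; rewrite /lexle /key_lt eq_c ltxx lexx /=.
by move=> hy /orP[//|/andP[]] *; lra.
Qed.

Variables (sel : seq nat) (rank : nat -> nat) (g0 : nat) (out : pred nat).
Hypotheses (sel_uniq : uniq sel) (sel_lt : all (gtn n) sel)
  (sel_chain : {in sel &, forall u v, (u < v)%N -> key (P u) (P v)})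
  (rank_lt : forall u, (u < n)%N -> (rank u < size sel)%N)
  (rank_incr : forall u v, (u < v)%N -> (v < n)%N -> key (P u) (P v) ->
     (rank u < rank v)%N).
Notation S := (map P sel).
Notation selected g := (fun i => (i \in S) && (group i == g)).
Hypotheses (outP : forall i, (i < n)%N -> out i = selected g0 i)
  (best : forall g, (count (selected g) D <= count (selected g0) D)%N).

(** In sorted order an independent set is a chain for [key], so [rank] is injective on it and has
    values below [size sel]. *)
Lemma alpha_le_chain : (alpha L <= size sel)%N.
Proof.
apply/bigmax_leqP_seq => I; rewrite fpowersetE => /fsubsetP IL /asboolP indI.
pose pos x := index (index x ls) (mkseq P n).
have posP x : x \in I -> (pos x < n)%N /\ l (P (pos x)) = x.
  move=> /IL; rewrite -lsL => xls.
  have iD : index x ls \in mkseq P n by rewrite (perm_mem permP) DE index_mem.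
  have pn : (pos x < n)%N by rewrite -[X in (_ < X)%N](size_mkseq P n) index_mem.
  by split=> //; rewrite -(nth_mkseq 0%N P pn) nth_index // nth_index.
have rank_inj x y : x \in I -> y \in I -> (pos x < pos y)%N ->
    (rank (pos x) < rank (pos y))%N.
  move=> xI yI lt_xy; have [xn lx] := posP x xI; have [yn ly] := posP y yI.
  apply: rank_incr => //; apply: nonadjacent_key => //; rewrite lx ly.
  exact: indI.
rewrite -(size_map (rank \o pos)) -(size_iota 0 (size sel)).
apply: uniq_leq_size.
  rewrite map_inj_in_uniq ?fset_uniq // => x y xI yI /= eq_r.
  have [lt_xy|lt_xy|eq_p] := ltngtP (pos x) (pos y).
  - by have := rank_inj x y xI yI lt_xy; rewrite eq_r ltnn.
  - by have := rank_inj y x yI xI lt_xy; rewrite eq_r ltnn.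
  - by have [_ <-] := posP x xI; have [_ <-] := posP y yI; rewrite eq_p.
move=> _ /mapP[x xI ->]; rewrite mem_iota /=.
by apply: rank_lt; have [] := posP x xI.
Qed.

Lemma chain_le_groups :
  (size sel <= 36 * na * nb * count (selected g0) D)%N.
Proof.
have SD i : i \in S -> i \in D.
  by move=> /mapP[u /(allP sel_lt) /= un ->]; exact: P_lt.
have S_uniq : uniq S.
  rewrite map_inj_in_uniq // => u v /(allP sel_lt) /= un /(allP sel_lt) /= vn.
  exact: P_inj.
have countS g : count (fun i => group i == g) S = count (selected g) D.
  have perm_S : perm_eq S [seq i <- D | i \in S].
    apply: uniq_perm; rewrite ?filter_uniq ?iota_uniq // => i.
    by rewrite mem_filter /=; case: (boolP (i \in S)) => // /SD ->.
  rewrite (seq.permP perm_S) count_filter; apply: eq_count => i /=; exact: andbC.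
(* Pigeonhole on the data defining a group; the 36 is 4 shapes times 3 times 3 residues. *)
pose code i := ((((shape_code (l i), ca i), cb i), (p i %% 3)%N), (q i %% 3)%N).
pose codes := [seq (x, y) | x <- [seq (x, y) | x <- [seq (x, y) |
  x <- [seq (x, y) | x <- iota 0 4, y <- iota 1 na], y <- iota 1 nb],
  y <- iota 0 3], y <- iota 0 3].
have size_codes : size codes = (36 * na * nb)%N.
  by rewrite !size_allpairs !size_iota; lia.
rewrite -size_codes -(size_map P); apply: (@size_le_fibers _ _ code).
  move=> i /SD iD; rewrite /code.
  apply: (allpairs_f pair); first apply: (allpairs_f pair);
    first apply: (allpairs_f pair); first apply: (allpairs_f pair);
    rewrite mem_iota.
  - exact: shape_lt4.
  - by have := bk_id Ba iD; lia.
  - by have := bk_id Bb iD; lia.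
  - by rewrite /= ltn_mod.
  - by rewrite /= ltn_mod.
move=> i iS; apply: leq_trans (best (group i)); rewrite -countS.
rewrite -!size_filter; apply: uniq_leq_size; first exact: filter_uniq.
move=> j; rewrite !mem_filter => /andP[/eqP[h1 h2 h3 h4 h5] jS]; rewrite jS andbT.
by apply/eqP/(groupP (SD _ jS) (SD _ iS)).
Qed.

Notation O := [fset x in mask [seq out i | i <- D] ls]%fset.

Lemma mem_out x : x \in O ->
  exists u, [/\ u \in sel, (u < n)%N, x = l (P u) & group (P u) = g0].
Proof.
rewrite inE (mask_map_iota (ell0 R)) => /mapP[i]; rewrite mem_filter DE.
move=> /andP[oi ni] ->; move: oi; rewrite outP // => /andP[/mapP[u uS ->] /eqP gu].
by exists u; split=> //; exact: (allP sel_lt).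
Qed.

Lemma out_sub : (O `<=` L)%fset.
Proof.
apply/fsubsetP => x /mem_out[u [_ un -> _]]; rewrite -lsL mem_nth //.
by have := P_lt un; rewrite DE.
Qed.

Lemma out_independent : independent O.
Proof.
move=> _ _ /mem_out[u [us un -> gu]] /mem_out[v [vs vn -> gv]] adj.
have guv : group (P u) = group (P v) by rewrite gu.
have [uv|uv|uv] := ltngtP u v.
- by apply: (key_nonadjacent uv vn guv _ adj); exact: sel_chain.
- by apply: (key_nonadjacent uv un (esym guv) _ (ell_adjacent_sym adj)); exact: sel_chain.
- by case: adj; rewrite uv.
Qed.

Lemma card_out : #|` O| = count (selected g0) D.
Proof.
rewrite card_fseq (mask_map_iota (ell0 R)) undup_id.
  rewrite size_map size_filter; apply: eq_in_count => i; rewrite DE => ni.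
  exact: outP.
rewrite map_inj_in_uniq ?filter_uniq ?iota_uniq // => i j.
by rewrite !mem_filter => /andP[_ iD] /andP[_ jD]; exact: l_inj.
Qed.

End Selection.

(** * The algorithm *)

Section Stages.
Variable R : realType.
Implicit Type s : state R.

(** Banks 1, 7 and 8 are the output, the marks of the chain and the group counters, which the final
    phases expect to be zero. *)
Definition ready s n := [/\ nmem s 0 0 = n,
  perm_eq (mkseq (nmem s 2) n) (iota 0 n) &
  forall b i, b \in [:: 1; 7; 8] -> nmem s b i = 0].

Definition same_below o s s' := forall b, 2 < b < o -> rmem s' b = rmem s b.

(** Only real banks occur here: natural-number bank 9 is overwritten by the next bucketing. *)
Definition bucket_fact s n (spec : nat * nat * nat * nat) : Prop :=
  let: (C, K, W, o) := spec in
  exists nb e id,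
    bucketing (rmem s C) (rmem s K) (rmem s W) (iota 0 n) nb e id /\
    forall i, i < n -> [/\ rmem s o i = (id i)%:R%R,
      rmem s o.+1 i = (id i %% 3)%:R%R & rmem s o.+2 i = rmem s K (e (id i))].

Definition bucket_cmd (spec : nat * nat * nat * nat) : cmd :=
  let: (C, K, W, o) := spec in bucket C K W o.

Definition valid_spec (spec : nat * nat * nat * nat) : bool :=
  let: (C, K, W, o) := spec in [&& 2 < C < o, 2 < K < o & 2 < W < o].

Definition out_bank (spec : nat * nat * nat * nat) : nat := spec.2.

(* Every real bank from 3 on is written by at most one stage, so what a stage
   establishes still holds in all later states. *)
Definition stage s0 s n (specs : seq (nat * nat * nat * nat)) : Prop :=
  [/\ ready s n, same_below 20 s0 s & {in specs, forall sp, bucket_fact s n sp}].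

Lemma bucket_fact_below s s' n spec o : valid_spec spec -> out_bank spec + 2 < o ->
  same_below o s s' -> bucket_fact s n spec -> bucket_fact s' n spec.
Proof.
case: spec => [[[C K] W] o'] /= /and3P[hC hK hW]; rewrite /out_bank /= => ho sb.
move=> [nb [e [id [B H]]]]; exists nb, e, id.
by rewrite !sb; try lia.
Qed.

Lemma stage_step spec (specs : seq (nat * nat * nat * nat)) :
  valid_spec spec && (20 <= out_bank spec) ->
  all (fun sp => valid_spec sp && (out_bank sp + 2 < out_bank spec)) specs ->
  exists T, forall s0 s n, stage s0 s n specs ->
    (forall i, i < n -> (0 < rmem s spec.1.2 i)%R) ->
    runs (bucket_cmd spec) s (T * nlogn n) (fun s' =>
      stage s0 s' n (spec :: specs) /\
      forall i, i < n -> rmem s' (out_bank spec) i = (nmem s' 9 i)%:R%R).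
Proof.
case: spec => [[[C K] W] o]; rewrite /out_bank /= => /andP[/and3P[hC hK hW] ho] Hsp.
have [T run] := bucket_runs R hC hK hW.
exists T => s0 s n [[sn permA zeros] sb facts] Wpos.
have /runs_frame := run s n sn permA Wpos.
move=> /runs_weaken; apply=> // s' [[permA' [nb [e [id [B i9 r1 r2 r3]]]]] fn fr].
have sb' : same_below o s s'.
  by move=> b b_o; apply: fr; rewrite /= !inE; lia.
split; last by move=> i ni; rewrite r1 // i9.
split.
- split=> //; first by rewrite fn.
  by move=> b i hb; rewrite fn ?zeros //; move: hb; rewrite !inE => /or3P[] /eqP ->.
- by move=> b b20; rewrite sb' ?sb //; lia.
- move=> sp; rewrite inE => /predU1P[->|spL]; last first.
    have /andP[v lt_o] := allP Hsp sp spL.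
    exact: bucket_fact_below v lt_o sb' (facts sp spL).
  exists nb, e, id; rewrite !(sb' C, sb' K, sb' W); try lia.
  by split=> // i ni; split; [exact: r1 | exact: r2 | exact: r3].
Qed.

End Stages.

(* Buckets of arm lengths (20, 23), of corners within a class of lengths
   (26, 29), cells (32, 35) and groups (38, 41, 44, 47). *)
Definition ell_algorithm : cmd :=
  Seq preprocess
  (Seq (bucket_cmd (6, 8, 8, 20))
  (Seq (bucket_cmd (6, 9, 9, 23))
  (Seq (bucket_cmd (20, 10, 22, 26))
  (Seq (bucket_cmd (23, 11, 25, 29))
  (Seq (bucket_cmd (12, 26, 7, 32))
  (Seq (bucket_cmd (32, 29, 7, 35))
  (Seq (bucket_cmd (12, 20, 7, 38))
  (Seq (bucket_cmd (38, 23, 7, 41))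
  (Seq (bucket_cmd (41, 27, 7, 44))
  (Seq (bucket_cmd (44, 30, 7, 47))
  (Seq (merge_sort 35 10 11)
  (Seq (longest_chain 35 11)
       (Seq count_groups write_output))))))))))))).

Section Run.
Variable R : realType.
Implicit Type s : state R.

(** The latest stage comes first, so the stages already run always form a [drop] of this list. *)
Definition all_specs : seq (nat * nat * nat * nat) :=
  [:: (44, 30, 7, 47); (41, 27, 7, 44); (38, 23, 7, 41); (12, 20, 7, 38);
      (32, 29, 7, 35); (12, 26, 7, 32); (23, 11, 25, 29); (20, 10, 22, 26);
      (6, 9, 9, 23); (6, 8, 8, 20)].

Lemma ell_algorithm_runs : exists T, forall ls : seq (ell R),
  let n := size ls in
  runs ell_algorithm (input ls) (T * nlogn n) (fun s' =>
    exists s0 s P group sel rank g0,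
    [/\ preprocessed ls s0 /\ (forall i, rmem s0 6 i = 0%R),
        stage s0 s n all_specs /\ (forall i, i < n -> rmem s 47 i = (group i)%:R%R),
        perm_eq (mkseq P n) (iota 0 n) /\
        (forall u v, u <= v -> v < n ->
          lexle (rmem s 35) (rmem s 10) (rmem s 11) (P u) (P v)),
        [/\ uniq sel, all (gtn n) sel,
          {in sel &, forall u v, u < v ->
            key_lt (rmem s 35) (rmem s 11) (P u) (P v)},
          forall u, u < n -> rank u < size sel &
          forall u v, u < v -> v < n ->
            key_lt (rmem s 35) (rmem s 11) (P u) (P v) -> rank u < rank v] &
        let selected g i := (i \in map P sel) && (group i == g) in
        (forall i, i < n -> (nmem s' 1 i != 0) = selected g0 i) /\
        forall g, count (selected g) (iota 0 n) <=
          count (selected g0) (iota 0 n)]).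
Proof.
have [T1 step1] := @stage_step R (6, 8, 8, 20) [::] isT isT.
have [T2 step2] := @stage_step R (6, 9, 9, 23) (drop 9 all_specs) isT isT.
have [T3 step3] := @stage_step R (20, 10, 22, 26) (drop 8 all_specs) isT isT.
have [T4 step4] := @stage_step R (23, 11, 25, 29) (drop 7 all_specs) isT isT.
have [T5 step5] := @stage_step R (12, 26, 7, 32) (drop 6 all_specs) isT isT.
have [T6 step6] := @stage_step R (32, 29, 7, 35) (drop 5 all_specs) isT isT.
have [T7 step7] := @stage_step R (12, 20, 7, 38) (drop 4 all_specs) isT isT.
have [T8 step8] := @stage_step R (38, 23, 7, 41) (drop 3 all_specs) isT isT.
have [T9 step9] := @stage_step R (41, 27, 7, 44) (drop 2 all_specs) isT isT.
have [T10 step10] := @stage_step R (44, 30, 7, 47) (drop 1 all_specs) isT isT.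
have [T11 sort] := merge_sort_runs R 35 10 11.
have [T12 lis] := longest_chain_runs R 35 11.
(* Preprocessing and selection account for 1000 each. *)
exists (2000 + T1 + T2 + T3 + T4 + T5 + T6 + T7 + T8 + T9 + T10 + T11 + T12).
move=> ls n; rewrite /ell_algorithm.
apply: runs_cost.
- have /runs_frame prep := preprocess_runs ls.
  apply: (runs_seq prep) => s0 {prep} [prep fn0 fr0].
  have s0_6 i : rmem s0 6 i = 0%R by rewrite (fr0 6).
  have st0 : stage s0 s0 n [::].
    split=> //; split.
    + by rewrite fn0.
    + rewrite (_ : mkseq _ _ = iota 0 n) // -[RHS]map_id /mkseq.
      apply/eq_in_map => i; rewrite mem_iota => ni.
      by have [] := prep i ni.
    + by move=> b i; rewrite !inE => /or3P[] /eqP ->; rewrite fn0.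
  have pos s sps : stage s0 s n sps -> forall i, i < n ->
      [/\ (0 < rmem s 7 i)%R, (0 < rmem s 8 i)%R & (0 < rmem s 9 i)%R].
    move=> [_ sb _] i ni; rewrite !sb //.
    have [_ [-> -> ->] _ _ _] := prep i ni.
    by split; [exact: ltr01 | exact: hlen_gt0 | exact: vlen_gt0].
  (* The shortest length of a class is a length, hence positive, and can serve as the width of the
     strips. *)
  have pos_start C K W o s sps : stage s0 s n sps -> (C, K, W, o) \in sps ->
      (forall i, i < n -> (0 < rmem s K i)%R) ->
      forall i, i < n -> (0 < rmem s o.+2 i)%R.
    move=> [_ _ facts] /facts[nb [e [id [B H]]]] Kpos i ni.
    have [_ _ ->] := H i ni; apply: Kpos.
    have iD : i \in iota 0 n by rewrite mem_iota.
    by have := bk_first B (bk_id B iD); rewrite mem_iota.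
  apply: (runs_seq (step1 s0 s0 n st0 _)) => [i ni|];
    first by have [] := pos _ _ st0 i ni.
  move=> s1 [st1 _].
  apply: (runs_seq (step2 s0 s1 n st1 _)) => [i ni|];
    first by have [] := pos _ _ st1 i ni.
  move=> s2 [st2 _].
  apply: (runs_seq (step3 s0 s2 n st2 _)) => [|s3 [st3 _]].
    apply: (pos_start 6 8 8 20 _ _ st2) => // i ni; by have [] := pos _ _ st2 i ni.
  apply: (runs_seq (step4 s0 s3 n st3 _)) => [|s4 [st4 _]].
    apply: (pos_start 6 9 9 23 _ _ st3) => // i ni; by have [] := pos _ _ st3 i ni.
  apply: (runs_seq (step5 s0 s4 n st4 _)) => [i ni|];
    first by have [] := pos _ _ st4 i ni.
  move=> s5 [st5 _].
  apply: (runs_seq (step6 s0 s5 n st5 _)) => [i ni|];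
    first by have [] := pos _ _ st5 i ni.
  move=> s6 [st6 _].
  apply: (runs_seq (step7 s0 s6 n st6 _)) => [i ni|];
    first by have [] := pos _ _ st6 i ni.
  move=> s7 [st7 _].
  apply: (runs_seq (step8 s0 s7 n st7 _)) => [i ni|];
    first by have [] := pos _ _ st7 i ni.
  move=> s8 [st8 _].
  apply: (runs_seq (step9 s0 s8 n st8 _)) => [i ni|];
    first by have [] := pos _ _ st8 i ni.
  move=> s9 [st9 _].
  apply: (runs_seq (step10 s0 s9 n st9 _)) => [i ni|];
    first by have [] := pos _ _ st9 i ni.
  move=> s [st groupE]; have [[sn permA zeros] _ _] := st.
  have /runs_frame {}sort := sort s n sn permA.
  apply: (runs_seq sort) => t [[permP sorted] fnt frt].
  have {}frt : rmem t = rmem s by apply/funext => b; rewrite frt.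
  have tn : nmem t 0 0 = n by rewrite fnt.
  have t7 i : nmem t 7 i = 0 by rewrite fnt // zeros.
  have /runs_frame {}lis := lis t n tn t7.
  apply: (runs_seq lis) => t'.
  move=> [[m [sel [rank [[sz us] lt_sel ch sel7 [rk1 rk2]]]]] fnt' frt'].
  have t'n : nmem t' 0 0 = n by rewrite fnt'.
  have t'8 i : nmem t' 8 i = 0 by rewrite fnt' // fnt // zeros.
  have t'1 i : nmem t' 1 i = 0 by rewrite fnt' // fnt // zeros.
  have := select_group_runs t'n t'8 t'1 => /runs_weaken; apply; first exact: leqnn.
  move=> s' [g0 [outE best]].
  exists s0, s, (nmem t 2), (nmem s 9), sel, rank, g0.
  have t'9 : nmem t' 9 = nmem s 9 by rewrite fnt' // fnt.
  move: ch rk2; rewrite /pos_lt !frt => ch rk2.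
  split=> //; first by split=> // u un; rewrite sz; exact: rk1.
  have selE g : count (fun i => (nmem t' 7 i != 0) && (nmem t' 9 i == g)) (iota 0 n) =
      count (fun i => (i \in map (nmem t 2) sel) && (nmem s 9 i == g)) (iota 0 n).
    by apply: eq_count => i /=; rewrite sel7 t'9.
  by split=> [i ni|g]; [rewrite outE // sel7 t'9 | rewrite -!selE].
- have := leq_nlogn n; rewrite /= !mulnDl; lia.
Qed.

End Run.

Local Open Scope classical_set_scope.
Local Open Scope ring_scope.

(** * Number of length classes and asymptotic running time *)

Section Bounds.
Variable R : realType.

(** The starts of the classes at least double, so [2 ^ (nb - 1)] is at most the ratio of the extreme
    lengths; the factor 2 under the logarithm pays for the first class. *)
Lemma class_count (f : ell R -> R) (L : {fset ell R}) (ls : seq (ell R)) nb e id :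
  let g i := f (nth (ell0 R) ls i) in
  (forall l, 0 < f l) -> ls =i L -> (0 < size ls)%N ->
  bucketing (fun=> 0) g g (iota 0 (size ls)) nb e id ->
  (0 < nb)%N /\ nb%:R <= log2 (2 * (max_over f L / min_over f L)).
Proof.
move=> g f0 lsL n0 B.
have D0 : 0%N \in iota 0 (size ls) by rewrite mem_iota.
have nb0 : (0 < nb)%N by have := bk_id B D0; lia.
split=> //.
have inL b : (0 < b <= nb)%N -> nth (ell0 R) ls (e b) \in L.
  by move=> /(bk_first B); rewrite mem_iota -lsL => ?; exact: mem_nth.
have le_e : g (e 1%N) * 2 ^+ nb.-1 <= g (e nb).
  rewrite -[in X in _ <= X](prednK nb0); apply: (bucketing_double B); last lia.
  by move=> i _; exact: f0.
have e1L : nth (ell0 R) ls (e 1%N) \in L by apply: inL; lia.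
have enL : nth (ell0 R) ls (e nb) \in L by apply: inL; lia.
have min0 := min_over_gt0 e1L f0.
have ratio : 2 ^+ nb.-1 <= max_over f L / min_over f L.
  rewrite ler_pdivlMr // mulrC; apply: le_trans (max_over_ge f enL).
  by apply: le_trans le_e; rewrite ler_pM2r ?exprn_gt0 //; exact: min_over_le.
have ratio0 : 0 < max_over f L / min_over f L.
  by apply: lt_le_trans ratio; rewrite exprn_gt0.
rewrite log2_double // -(prednK nb0) -natr1 addrC lerD2l.
exact: pow2_log2.
Qed.

Lemma nlogn_bigO (c : nat) :
  (fun n : nat => (c * nlogn n)%:R : R) =O_\oo
  (fun n : nat => n%:R * log2 n%:R ^+ 2 : R).
Proof.
(* For [n >= 2] one has [n + 1 <= 2n] and [up_log 2 n + 1 <= log2 n + 2 <= 3 log2 n], whence the 6;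
   the added 1 keeps the constant positive when [c = 0]. *)
apply/eqO_exP; exists (6 * c%:R + 1); first by rewrite ltr_wpDl ?mulr_ge0.
near=> n.
have n2 : (2 <= n)%N by near: n; exact: nbhs_infty_ge.
have lg1 : 1 <= log2 n%:R :> R.
  by apply: (@pow2_log2 _ 1); rewrite expr1 ler_nat.
have lgu : (up_log 2 n)%:R <= log2 n%:R + 1 :> R.
  have u0 : (0 < up_log 2 n)%N by rewrite up_log_gt0; lia.
  rewrite -(prednK u0) -natr1 lerD2r; apply: pow2_log2.
  have /andP[lt_n _] := up_log_bounds (isT : (1 < 2)%N) n2.
  by rewrite -natrX ler_nat ltnW.
have n0 : 2 <= n%:R :> R by rewrite (ler_nat _ 2).
rewrite !ger0_norm //; last by rewrite mulr_ge0 ?exprn_ge0 //; lra.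
rewrite /nlogn !natrM -[n.+1%:R]natr1 -[(up_log 2 n).+1%:R]natr1.
have h1 : (n%:R + 1) * ((up_log 2 n)%:R + 1) <= 6 * (n%:R * log2 n%:R ^+ 2) :> R.
  apply: (@le_trans _ _ ((2 * n%:R) * (3 * log2 n%:R ^+ 2))); last first.
    by rewrite le_eqVlt; apply/orP; left; apply/eqP; ring.
  apply: ler_pM; rewrite ?addr_ge0 //; first lra.
  apply: (@le_trans _ _ (3 * log2 n%:R)); first lra.
  by rewrite ler_pM2l // expr2 ler_peMl //; lra.
set A := n%:R * log2 n%:R ^+ 2 in h1 *.
have A0 : 0 <= A by rewrite /A mulr_ge0 ?exprn_ge0 //; lra.
have -> : (6 * c%:R + 1) * A = c%:R * (6 * A) + A by ring.
by apply: ler_wpDr => //; exact: ler_wpM2l.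
Unshelve. all: by end_near.
Qed.

End Bounds.

Theorem theorem2 (R : realType) :
  exists (algorithm : cmd) (T : nat -> nat),
    ((fun n : nat => (T n)%:R : R) =O_\oo
      (fun n : nat => n%:R * log2 n%:R ^+ 2 : R)) /\
    forall (L : {fset ell R}) (ls : seq (ell R)),
      uniq ls -> ls =i L ->
      exists (s : state R) (t : nat),
        [/\ exec algorithm (input ls) s t,
            (t <= T #|` L|)%N,
            (output ls s `<=` L)%fset,
            independent (output ls s) &
            (alpha L)%:R / (36 * log2 (2 * dx L) * log2 (2 * dy L))
              <= #|` output ls s|%:R :> R].
Proof.
have [T run] := ell_algorithm_runs R.
exists ell_algorithm, (fun n => (T * nlogn n)%N); split; first exact: nlogn_bigO.
move=> L ls ls_uniq lsL; set n := size ls.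
have nL : n = #|` L| by exact: perm_size (uniq_perm ls_uniq (fset_uniq L) lsL).
have [s' [t [E le_t]]] := run ls; rewrite -/n in le_t *.
move=> [s0 [s [P [group [sel [rank [g0]]]]]]].
move=> [[prep s0_6] [[rdy sb facts] groupE] [permP sorted]].
move=> [sel_uniq sel_lt sel_chain rank_lt rank_incr] [outE best].
exists s', t; pose l := nth (ell0 R) ls.
have DE i : (i \in iota 0 n) = (i < n)%N by rewrite mem_iota.
have s6 i : rmem s 6 i = 0 by rewrite sb.
have s7 : {in iota 0 n, forall i, rmem s 7 i = 1%R}.
  by move=> i; rewrite DE sb // => /prep[_ []].
have s8 : {in iota 0 n, forall i, rmem s 8 i = hlen (l i)}.
  by move=> i; rewrite DE sb // => /prep[_ []].
have s9 : {in iota 0 n, forall i, rmem s 9 i = vlen (l i)}.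
  by move=> i; rewrite DE sb // => /prep[_ []].
have s10 : {in iota 0 n, forall i, rmem s 10 i = norm_x (l i)}.
  by move=> i; rewrite DE sb // => /prep[_ _].
have s11 : {in iota 0 n, forall i, rmem s 11 i = norm_y (l i)}.
  by move=> i; rewrite DE sb // => /prep[_ _ _].
have s12 : {in iota 0 n, forall i, rmem s 12 i = (shape_code (l i))%:R%R}.
  by move=> i; rewrite DE sb // => /prep[_ _ _ _].
have [na [ea [ca [Ba Ha]]]] := facts (6, 8, 8, 20) isT.
have [nb [eb [cb [Bb Hb]]]] := facts (6, 9, 9, 23) isT.
have [np [ep [p [Bp Hp]]]] := facts (20, 10, 22, 26) isT.
have [nq [eq [q [Bq Hq]]]] := facts (23, 11, 25, 29) isT.
have [n1 [e1 [c1 [B1 H1]]]] := facts (12, 26, 7, 32) isT.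
have [n2 [e2 [cell [B2 H2]]]] := facts (32, 29, 7, 35) isT.
have [n3 [e3 [c3 [B3 H3]]]] := facts (12, 20, 7, 38) isT.
have [n4 [e4 [c4 [B4 H4]]]] := facts (38, 23, 7, 41) isT.
have [n5 [e5 [c5 [B5 H5]]]] := facts (41, 27, 7, 44) isT.
have [n6 [e6 [c6 [B6 H6]]]] := facts (44, 30, 7, 47) isT.
have inD (A B C : nat -> Prop) : (forall i, (i < n)%N -> [/\ A i, B i & C i]) ->
    [/\ {in iota 0 n, forall i, A i}, {in iota 0 n, forall i, B i} &
      {in iota 0 n, forall i, C i}].
  by move=> H; split=> i; rewrite DE => /H[].
have [Ha1 _ Ha3] := inD _ _ _ Ha; have [Hb1 _ Hb3] := inD _ _ _ Hb.
have [Hp1 Hp2 _] := inD _ _ _ Hp; have [Hq1 Hq2 _] := inD _ _ _ Hq.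
have [H11 _ _] := inD _ _ _ H1; have [H21 _ _] := inD _ _ _ H2.
have [H31 _ _] := inD _ _ _ H3; have [H41 _ _] := inD _ _ _ H4.
have [H51 _ _] := inD _ _ _ H5; have [H61 _ _] := inD _ _ _ H6.
(* The constant bank 6 puts all items into one class when lengths are bucketed. *)
have s6D : {in iota 0 n, rmem s 6 =1 fun=> 0} by move=> i _.
have Ba' := bucketing_eq s6D s8 s8 Ba; have Bb' := bucketing_eq s6D s9 s9 Bb.
have Wp : {in iota 0 n, rmem s 22 =1 fun i => hlen (l (ea (ca i)))}.
  by move=> i iD; rewrite Ha3 // s8 // (bk_first Ba') // (bk_id Ba').
have Wq : {in iota 0 n, rmem s 25 =1 fun i => vlen (l (eb (cb i)))}.
  by move=> i iD; rewrite Hb3 // s9 // (bk_first Bb') // (bk_id Bb').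
have Bp' := bucketing_eq Ha1 s10 Wp Bp; have Bq' := bucketing_eq Hb1 s11 Wq Bq.
(* The remaining stages number tuples one component at a time: [R1] and [R2] give the cells, [R3] to
   [R6] the groups. *)
have R1 := bucketing_refine (bucketing_eq s12 Hp1 s7 B1).
have R2 := bucketing_refine (bucketing_eq H11 Hq1 s7 B2).
have R3 := bucketing_refine (bucketing_eq s12 Ha1 s7 B3).
have R4 := bucketing_refine (bucketing_eq H31 Hb1 s7 B4).
have R5 := bucketing_refine (bucketing_eq H41 Hp2 s7 B5).
have R6 := bucketing_refine (bucketing_eq H51 Hq2 s7 B6).
have cellP : {in iota 0 n &, forall i j, cell i = cell j <->
    (shape_code (l i) = shape_code (l j) /\ p i = p j) /\ q i = q j}.
  by move=> i j iD jD; rewrite (R2 i j iD jD) (R1 i j iD jD).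
have groupP : {in iota 0 n &, forall i j, group i = group j <->
    (((shape_code (l i) = shape_code (l j) /\ ca i = ca j) /\ cb i = cb j) /\
    (p i %% 3 = p j %% 3)%N) /\ (q i %% 3 = q j %% 3)%N}.
  move=> i j iD jD; rewrite -(R3 i j iD jD) -(R4 i j iD jD) -(R5 i j iD jD).
  rewrite -(R6 i j iD jD); suff gE x : x \in iota 0 n -> group x = c6 x by rewrite !gE.
  move=> xD; have := H61 x xD; rewrite groupE -?DE // => /eqP.
  by rewrite eqr_nat => /eqP.
have PD u : (u < n)%N -> P u \in iota 0 n.
  by move=> un; rewrite -(perm_mem permP) map_f // DE.
have sorted' u v : (u <= v)%N -> (v < n)%N -> lexle (fun i => (cell i)%:R)
    (fun i => norm_x (l i)) (fun i => norm_y (l i)) (P u) (P v).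
  move=> uv vn; have un : (u < n)%N by lia.
  by have := sorted u v uv vn; rewrite /lexle !H21 ?s10 ?s11 ?PD.
have keyE u v : (u < n)%N -> (v < n)%N -> key_lt (rmem s 35) (rmem s 11) (P u) (P v)
    = key_lt (fun i => (cell i)%:R) (fun i => norm_y (l i)) (P u) (P v).
  by move=> un vn; rewrite /key_lt !H21 ?s11 ?PD.
have sel_chain' : {in sel &, forall u v, (u < v)%N ->
    key_lt (fun i => (cell i)%:R : R) (fun i => norm_y (l i)) (P u) (P v)}.
  move=> u v us vs uv; rewrite -keyE; first exact: sel_chain.
    exact: (allP sel_lt).
  exact: (allP sel_lt).
have rank_incr' u v : (u < v)%N -> (v < n)%N ->
    key_lt (fun i => (cell i)%:R : R) (fun i => norm_y (l i)) (P u) (P v) ->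
    (rank u < rank v)%N.
  by move=> uv vn; rewrite -keyE //; [exact: rank_incr | lia].
have le_alpha := alpha_le_chain ls_uniq lsL Ba' Bb' Bp' Bq' cellP permP sorted'
  rank_lt rank_incr'.
have le_groups := chain_le_groups ls_uniq Ba' Bb' groupP permP sel_uniq sel_lt best.
split=> //.
- by rewrite -nL.
- exact: (out_sub lsL permP sel_lt outE).
- exact: (out_independent ls_uniq Ba' Bb' Bp' Bq' cellP groupP permP sorted'
    sel_lt sel_chain' outE).
rewrite /output (card_out ls_uniq outE).
(* The empty input is separate: [dx] and [dy] are then 0 by convention, and the logarithms need not
   be positive. *)
case: (posnP n) => [n0|n_gt0].
  have -> : alpha L = 0%N.
    apply/eqP; rewrite -leqn0; apply: leq_trans le_alpha _.
    by case: (sel) sel_lt => //= u sel' /andP[]; rewrite -/n n0.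
  by rewrite !mul0r.
have [na0 le_na] := class_count (@hlen_gt0 R) lsL n_gt0 Ba'.
have [nb0 le_nb] := class_count (@vlen_gt0 R) lsL n_gt0 Bb'.
rewrite -/(dx L) in le_na; rewrite -/(dy L) in le_nb.
have lx0 : 0 < log2 (2 * dx L) by apply: lt_le_trans le_na; rewrite ltr0n.
have ly0 : 0 < log2 (2 * dy L) by apply: lt_le_trans le_nb; rewrite ltr0n.
rewrite ler_pdivrMr; last by rewrite (mulr_gt0 (mulr_gt0 _ lx0) ly0).
(* The chain has at least [alpha L] members, and the most popular group contains at least its share
   of them; [na] and [nb] are then replaced by their logarithmic bounds. *)
apply: (@le_trans _ _ (36 * na * nb * count (fun i => (i \in map P sel) &&
  (group i == g0)) (iota 0 n))%:R).
  by rewrite ler_nat; exact: leq_trans le_groups.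
rewrite natrM mulrC; apply: ler_wpM2l => //.
rewrite !natrM; apply: ler_pM => //.
by apply: ler_pM.
Qed.
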